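(* Let $(\mathbb{X},d)$ be a metric measure space with a polar decomposition at a point $a\in\mathbb{X}$, let $s>0$ and $1<p<q<\infty$, with $p'=\frac p{p-1}$, $q'=\frac q{q-1}$. Let $v$ and $z$ be non-negative measurable functions on $\mathbb{X}$, and define $$V(x)=\int_{B(a,|x|_a)}v(y)\,dy,\qquad A(x):=\frac{1}{|B(a,|x|_a)|^{\frac qp}}\left(\int_{B(a,|x|_a)}\left(\frac{v^p(y)}{z(y)}\right)^{\frac1{p-1}}dy\right)^{-\frac q{p'}}V^q(x)\,v(x),$$ $$D_1:=\sup_{x\neq a}\left[\left(\int_{\mathbb{X}\setminus B(a,|x|_a)}\frac{A(y)}{|y|_a^{sq}V^q(y)}\,dy\right)^{\frac1q}\left(\int_{B(a,|x|_a)}\left(\frac{A(y)v^{-q}(y)}{|y|_a^{sq}}\right)^{1-q'}dy\right)^{\frac1{q'}}\right],$$ and assume $D_1<\infty$ and $(q')^{\frac1{q'}}q^{\frac1q}D_1<1$. Then there is a constant $C>0$ such that for every measurable $u$ on $\mathbb{X}$ for which $G:=A^{\frac1q}|u|\,|\cdot|_a^{-s}$ belongs to $L^p(\mathbb{X})\cap L^q(\mathbb{X})$ and is not a.e. zero, $$\int_{\mathbb{X}}\frac{G^p}{\|G\|^p_{L^p(\mathbb{X})}}\log\left(\frac{G^p}{\|G\|^p_{L^p(\mathbb{X})}}\right)dx\le\frac{q}{q-p}\log\left(C\,\frac{\left(\int_{\mathbb{X}}\left(\int_{\mathbb{X}}\frac{|u(x)-u(y)|^pz(x)}{d^{sp}(x,y)\left|B\left(a,\frac{d(x,y)}2\right)\right|}dx\right)^{\frac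 qp}v(y)\,dy\right)^{\frac pq}}{\|G\|^p_{L^p(\mathbb{X})}}\right).$$
   Context: $(\mathbb{X},d)$ is a metric space equipped with a Borel measure $dx$; $|E|$ denotes the measure of a set $E$. $B(a,r)=\{x\in\mathbb{X}: d(x,a)<r\}$ and $|x|_a:=d(a,x)$. ''Polar decomposition at $a$'' means: there is a locally integrable function $\lambda$ such that, with $\Sigma_r=\{x\in\mathbb{X}: d(x,a)=r\}$ equipped with a measure $d\omega_r$, for every $f\in L^1(\mathbb{X})$ one has $\int_{\mathbb{X}}f(x)\,dx=\int_0^\infty\int_{\Sigma_r}f(r,\omega)\lambda(r,\omega)\,d\omega_r\,dr$. The constant $C$ is independent of $u$. *)

(* Defs.v *)
From HB Require Import structures.
From mathcomp Require Import all_boot all_order all_algebra.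
From mathcomp Require Import all_classical all_reals all_analysis measurable_realfun.
Set Implicit Arguments. Unset Strict Implicit. Unset Printing Implicit Defensive.
Import Order.TTheory GRing.Theory Num.Theory.
Local Open Scope classical_set_scope.
Local Open Scope ring_scope.

Section defs.
Context {R : realType}.
Local Open Scope ereal_scope.

Definition epow (x : \bar R) (r : R) : \bar R :=
  match x with
  | x'%:E => if x' == 0%R then (if (r < 0)%R then +oo else if r == 0%R then 1 else 0)
             else (x' `^ r)%:E
  | +oo => if (r < 0)%R then 0 else if r == 0%R then 1 else +oo
  | -oo => 0
  end.

(** 1/x with 1/0 = +oo, 1/+oo = 0. *)
Definition einv (x : \bar R) : \bar R := epow x (-1)%R.

Definition eln (x : \bar R) : \bar R :=
  match x with
  | x'%:E => if (x' <= 0)%R then -oo else (ln x')%:E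
  | +oo => +oo
  | -oo => -oo
  end.
End defs.

Definition oball {X : Type} {R : realType} (d : X -> X -> R) (a : X) (r : R) : set X :=
  [set x | d a x < r].
Definition sphere {X : Type} {R : realType} (d : X -> X -> R) (a : X) (r : R) : set X :=
  [set x | d a x = r].

Definition is_metric {X : Type} {R : realType} (d : X -> X -> R) : Prop :=
  (forall x y, 0 <= d x y) /\ (forall x y, d x y = 0 <-> x = y) /\
  (forall x y, d x y = d y x) /\ (forall x y w, d x w <= d x y + d y w).

Definition polar_decomposition {dX : measure_display} {X : measurableType dX}
  {R : realType} (mu : {measure set X -> \bar R}) (d : X -> X -> R) (a : X) : Prop :=
  exists (lambda : R -> X -> R) (omega : R -> {measure set X -> \bar R}),
    forall f : X -> R, mu.-integrable setT (fun x => (f x)%:E) ->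
      (\int[mu]_x (f x)%:E =
       \int[lebesgue_measure]_(r in `[0%R, +oo[%classic)
          \int[omega r]_(w in sphere d a r) (f w * lambda r w)%:E)%E.

Section weights.
Context {dX : measure_display} {X : measurableType dX} {R : realType}
  (mu : {measure set X -> \bar R}) (d : X -> X -> R) (a : X)
  (s p q : R) (v z : X -> R).
Local Open Scope ereal_scope.

Definition conj_exp (r : R) : R := (r / (r - 1))%R.
Definition rad (x : X) : R := d a x.
Definition Bx (x : X) : set X := oball d a (rad x).

Definition Vf (x : X) : \bar R := \int[mu]_(y in Bx x) (v y)%:E.

Definition Wf (x : X) : \bar R :=
  \int[mu]_(y in Bx x) epow (((v y) `^ p)%:E * einv (z y)%:E) (1 / (p - 1))%R.

Definition Af (x : X) : \bar R :=
  epow (mu (Bx x)) (- (q / p))%R * epow (Wf x) (- (q / conj_exp p))%R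
  * epow (Vf x) q * (v x)%:E.

Definition D1_at (x : X) : \bar R :=
  epow (\int[mu]_(y in ~` Bx x)
          (Af y * einv (epow (rad y)%:E (s * q) * epow (Vf y) q))) (1 / q)%R
  * epow (\int[mu]_(y in Bx x)
          epow (Af y * epow (v y)%:E (- q)%R * einv (epow (rad y)%:E (s * q)))
               (1 - conj_exp q)%R) (1 / conj_exp q)%R.

Definition D1 : \bar R := ereal_sup [set D1_at x | x in [set x | x <> a]].

Definition Gf (u : X -> R) (x : X) : \bar R :=
  epow (Af x) (1 / q)%R * (`|u x|)%:E * epow (rad x)%:E (- s)%R.

Definition energy (u : X -> R) : \bar R :=
  epow (\int[mu]_y
     (epow (\int[mu]_x ((`|u x - u y| `^ p * z x)%:E
              * einv ((d x y `^ (s * p))%:E * mu (oball d a (d x y / 2)))))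
           (q / p)%R * (v y)%:E)) (p / q)%R.
End weights.

(* Main.v *)
(** By Jensen's inequality for the probability density [G^p / ||G||_p^p], the
    left-hand side is at most [q/(q-p) log (||G||_q^p / ||G||_p^p)], so it is
    enough to bound [||G||_q^q] by a multiple of [E], the integral whose power
    [p/q] is the energy. For [y <> a] write [u(y)] as its [v]-weighted mean over
    [B(a,|y|)] plus the mean of [u(y) - u(x)]. Hoelder's inequality and
    [d(x,y) < 2|y|] on that ball bound the contribution of the oscillation by
    [E]; the contribution of the mean is bounded, by the weighted Hardy
    inequality with Muckenhoupt constant [D_1], by [K^q ||G||_q^q] with
    [K = (q')^(1/q') q^(1/q) D_1 < 1], and is absorbed on the left since
    [||G||_q] is finite. The polar decomposition is used only to see that
    spheres around [a] are null for the dual Hardy weight. *)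
Require Import Defs.
From HB Require Import structures.
From mathcomp Require Import all_boot all_order all_algebra ring lra.
From mathcomp Require Import all_classical all_reals all_analysis measurable_realfun.
Import Order.TTheory GRing.Theory Num.Theory.
Import numFieldNormedType.Exports.
Local Open Scope classical_set_scope.
Local Open Scope ring_scope.

Set Implicit Arguments.
Unset Strict Implicit.
Unset Printing Implicit Defensive.

(** * Integrals of nonnegative functions *)

(** Two gaps in measurability shape the proof. [mu] is not assumed sigma-finite, so integrals over
    balls are handled as monotone functions of the radius, and Tonelli's theorem is applied only
    after restriction to a sigma-finite part. And [d] is known to be measurable only in each
    variable separately, so the outer integrand of the energy may fail to be measurable; it is
    compared with measurable functions lying below it.

    The weight [A] is built so that, once Hoelder's inequality has been applied to the oscillation,
    the powers of the ball measure, of [Wf] and of [Vf] cancel and only [v] remains. Mean and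
    oscillation are separated by convexity with weights [t] and [1 - t], which costs a factor
    [t^(1-q)] on the Hardy term. Since the Hardy constant is exactly [K^q], the choice
    [t = (1 + K) / 2] gives [t^(1-q) K^q <= t < 1], so that [K < 1] is enough for absorption. *)

Section integral_facts.
Context {d : measure_display} {T : measurableType d} {R : realType}.
Variable mu : {measure set T -> \bar R}.
Local Open Scope ereal_scope.

(** The integral is a supremum over the simple functions below the integrand, hence monotone without
    measurability. This is what makes the outer integral of the energy tractable. *)
Lemma ge0_le_integral_nonmeasurable (f g : T -> \bar R) :
  (forall x, 0 <= f x) -> (forall x, f x <= g x) ->
  \int[mu]_x f x <= \int[mu]_x g x.
Proof.
move=> f0 fg; have g0 x : 0 <= g x by exact: le_trans (fg x).
rewrite !ge0_integralTE//; apply: le_ereal_sup => _ [h hf <-].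
by exists h => // x; exact: le_trans (fg x).
Qed.

Lemma ae_eq0_integral0 (D : set T) (f : T -> \bar R) : measurable D ->
  measurable_fun D f -> (forall x, D x -> 0 <= f x) ->
  \int[mu]_(x in D) f x = 0 -> {ae mu, forall x, D x -> f x = 0}.
Proof.
move=> mD mf f0 If; apply/(ae_eq_integral_abs mu mD mf).
by rewrite -If; apply: eq_integral => x /set_mem Dx; rewrite gee0_abs// f0.
Qed.

Lemma integral_lty_ae (D : set T) (f : T -> \bar R) : measurable D ->
  measurable_fun D f -> (forall x, D x -> 0 <= f x) ->
  \int[mu]_(x in D) f x < +oo -> {ae mu, forall x, D x -> f x < +oo}.
Proof.
move=> mD mf f0 If.
have : mu.-integrable D f.
  apply/integrableP; split => //.
  under eq_integral => x /set_mem Dx do rewrite gee0_abs ?f0//.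
  exact: If.
move/(integrable_ae mD); apply: filterS => x /[apply].
by rewrite fin_numE ltey => /andP[].
Qed.

Lemma conjugate_poweR (a b : \bar R) (p q : R) : 0 <= a -> 0 <= b ->
  (0 < p)%R -> (0 < q)%R -> (p^-1 + q^-1 = 1)%R ->
  a `^ p^-1 * b `^ q^-1 <= p^-1%:E * a + q^-1%:E * b.
Proof.
move=> a0 b0 p0 q0 pq.
have p1 : (0 < p^-1)%R by rewrite invr_gt0.
have q1 : (0 < q^-1)%R by rewrite invr_gt0.
case: a a0 => [a| |]// a0; last first.
  rewrite gt0_muley ?lte_fin// addye ?leey//.
  by case: b b0 => [b| |]//= b0; rewrite gt0_muley ?lte_fin.
case: b b0 => [b| |]// b0; last first.
  by rewrite [X in _ <= _ + X]gt0_muley ?lte_fin// addey ?leey.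
rewrite !poweR_EFin -!EFinM -EFinD lee_fin.
rewrite !lee_fin in a0 b0.
have := @conjugate_powR _ (a `^ p^-1)%R (b `^ q^-1)%R p q (powR_ge0 _ _) (powR_ge0 _ _) p0 q0 pq.
rewrite -!powRrM !mulVf ?gt_eqF// !powRr1//.
by rewrite (mulrC a) (mulrC b).
Qed.

(** The pointwise bound is required only a.e., since the weights to which it is applied satisfy it
    only where they are finite. *)
Lemma hoelder_ge0 (D : set T) (f a b : T -> \bar R) (p q : R) :
  measurable D -> measurable_fun D f -> measurable_fun D a ->
  measurable_fun D b ->
  (forall x, D x -> 0 <= f x) -> (forall x, D x -> 0 <= a x) ->
  (forall x, D x -> 0 <= b x) ->
  (0 < p)%R -> (0 < q)%R -> (p^-1 + q^-1 = 1)%R ->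
  {ae mu, forall x, D x -> f x <= a x `^ p^-1 * b x `^ q^-1} ->
  \int[mu]_(x in D) f x <=
    (\int[mu]_(x in D) a x) `^ p^-1 * (\int[mu]_(x in D) b x) `^ q^-1.
Proof.
move=> mD mf ma mb f0 a0 b0 p0 q0 pq fab.
have p1 : (0 < p^-1)%R by rewrite invr_gt0.
have q1 : (0 < q^-1)%R by rewrite invr_gt0.
have Ia0 : 0 <= \int[mu]_(x in D) a x by exact: integral_ge0.
have Ib0 : 0 <= \int[mu]_(x in D) b x by exact: integral_ge0.
have f_eq0 : {ae mu, forall x, D x -> f x = 0} ->
    \int[mu]_(x in D) f x = 0.
  move=> H; rewrite -[RHS](integral0 mu D); apply: ge0_ae_eq_integral => //.
(* If one integral vanishes, the right-hand side is 0 even when the other is infinite, since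
   [0 * +oo = 0]; so [f = 0] a.e. has to be derived. *)
have [Ia|Ia] := eqVneq (\int[mu]_(x in D) a x) 0.
  rewrite f_eq0 ?mule_ge0 ?poweR_ge0//.
  have := ae_eq0_integral0 mD ma a0 Ia.
  move: fab; apply: filterS2 => x + + Dx => /(_ Dx) + /(_ Dx) a0x.
  rewrite a0x poweR0r ?gt_eqF// mul0e => fx.
  by apply/le_anti; rewrite fx f0.
have [Ib|Ib] := eqVneq (\int[mu]_(x in D) b x) 0.
  rewrite f_eq0 ?mule_ge0 ?poweR_ge0//.
  have := ae_eq0_integral0 mD mb b0 Ib.
  move: fab; apply: filterS2 => x + + Dx => /(_ Dx) + /(_ Dx) b0x.
  rewrite b0x poweR0r ?gt_eqF// mule0 => fx.
  by apply/le_anti; rewrite fx f0.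
have {Ia0}Ia0 : 0 < \int[mu]_(x in D) a x by rewrite lt0e Ia.
have {Ib0}Ib0 : 0 < \int[mu]_(x in D) b x by rewrite lt0e Ib.
have [Iay|Iay] := eqVneq (\int[mu]_(x in D) a x) +oo.
  by rewrite Iay poweRyr ?gt_eqF// gt0_mulye ?leey// poweR_gt0.
have [Iby|Iby] := eqVneq (\int[mu]_(x in D) b x) +oo.
  by rewrite Iby poweRyr ?gt_eqF// gt0_muley ?leey// poweR_gt0.
have [A AE] : exists A : R, \int[mu]_(x in D) a x = A%:E.
  exists (fine (\int[mu]_(x in D) a x)); rewrite fineK// ge0_fin_numE ?ltW//.
  by rewrite ltey.
have [B BE] : exists B : R, \int[mu]_(x in D) b x = B%:E.
  exists (fine (\int[mu]_(x in D) b x)); rewrite fineK// ge0_fin_numE ?ltW//.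
  by rewrite ltey.
rewrite AE BE; move: Ia0 Ib0; rewrite AE BE !lte_fin => A0 B0.
(* Young's inequality for [a / A] and [b / B], multiplied by [c], integrates to
   [c (p^-1 + q^-1) = c]. *)
set c := (A `^ p^-1 * B `^ q^-1)%R.
have c0 : (0 < c)%R by rewrite mulr_gt0 ?powR_gt0.
have pointwise : {ae mu, forall x, D x ->
    f x <= (c * p^-1 * A^-1)%:E * a x + (c * q^-1 * B^-1)%:E * b x}.
  move: fab; apply: filterS => x + Dx => /(_ Dx) /le_trans; apply.
  have := @conjugate_poweR (A^-1%:E * a x) (B^-1%:E * b x) p q
    (mule_ge0 _ (a0 _ Dx)) (mule_ge0 _ (b0 _ Dx)) p0 q0 pq.
  rewrite !lee_fin !invr_ge0 (ltW A0) (ltW B0) => /(_ isT isT).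
  rewrite !poweRM ?a0 ?b0 ?lee_fin ?invr_ge0 ?(ltW A0) ?(ltW B0)//.
  rewrite !muleA !poweR_EFin => Y.
  have : c%:E * (((A^-1) `^ p^-1)%:E * a x `^ p^-1 *
      ((B^-1) `^ q^-1)%:E * b x `^ q^-1) <=
      c%:E * (p^-1%:E * A^-1%:E * a x + q^-1%:E * B^-1%:E * b x).
    by rewrite lee_pmul2l ?lte_fin.
  rewrite muleDr//; last first.
    by rewrite ge0_adde_def// inE ?mule_ge0 ?a0 ?b0 ?lee_fin ?invr_ge0 ?ltW.
  rewrite !muleA -!EFinM; apply: le_trans.
  rewrite [in leRHS](muleAC _ (a x `^ p^-1)) -!EFinM.
  rewrite [X in X%:E](_ : _ = 1%R) ?mul1e//.
  rewrite /c -mulrA mulrACA.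
  by rewrite -!powRM ?invr_ge0 ?ltW// !mulfV ?gt_eqF// !powR1 mulr1.
have cp0 : (0 <= c * p^-1 * A^-1)%R
  by rewrite (mulr_ge0 (mulr_ge0 (ltW c0) (ltW p1)))// invr_ge0 ltW.
have cq0 : (0 <= c * q^-1 * B^-1)%R
  by rewrite (mulr_ge0 (mulr_ge0 (ltW c0) (ltW q1)))// invr_ge0 ltW.
apply: (@le_trans _ _ (\int[mu]_(x in D)
   ((c * p^-1 * A^-1)%:E * a x + (c * q^-1 * B^-1)%:E * b x))).
  apply: ae_ge0_le_integral => //.
    by move=> x Dx; rewrite adde_ge0// mule_ge0 ?a0 ?b0.
  by apply: emeasurable_funD; exact: measurable_funeM.
rewrite ge0_integralD//; first last.
- exact: measurable_funeM.
- by move=> x Dx; rewrite mule_ge0 ?b0.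
- exact: measurable_funeM.
- by move=> x Dx; rewrite mule_ge0 ?a0.
rewrite !ge0_integralZl// AE BE -!EFinM -EFinD lee_fin.
by rewrite !mulfVK ?gt_eqF// -mulrDr pq mulr1.
Qed.

End integral_facts.

(** Integrals over balls are monotone in the radius, so this yields their measurability without
    Fubini's theorem. *)
Lemma nonincreasing_emeasurable {R : realType} (f : R -> \bar R) :
  {homo f : x y / x <= y >-> (y <= x)%E} -> measurable_fun setT f.
Proof.
move=> fni; apply: (measurability _ (ErealGenOInfty.measurableE R)) => _ [_ [r ->] <-].
rewrite setTI; apply: is_interval_measurable => s t /=.
rewrite !in_itv/= !andbT => fs ft u /andP[su ut].
by rewrite in_itv/= andbT (lt_le_trans ft)// fni.
Qed.

Lemma nondecreasing_emeasurable {R : realType} (f : R -> \bar R) :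
  {homo f : x y / x <= y >-> (x <= y)%E} -> measurable_fun setT f.
Proof.
move=> fnd.
have mf : measurable_fun setT (fun x : R => f (- x)).
  by apply: nonincreasing_emeasurable => x y xy; apply: fnd; rewrite lerN2.
rewrite (_ : f = (fun x : R => f (- x)) \o -%R); first exact: measurableT_comp.
by apply/funext => x /=; rewrite opprK.
Qed.

(** * Exhaustion by sublevel sets *)

Section sublevel.
Context {d : measure_display} {T : measurableType d} {R : realType}.
Variable mu : {measure set T -> \bar R}.
Local Open Scope ereal_scope.

(** If [rho] attains its maximum on [E], then [E] is itself one of the sublevel sets. Otherwise [E]
    is the increasing union of the sets [rho <= s - 1/(n+1)], with [s] the supremum; each lies in
    the sublevel set of some point of [E], and monotone convergence passes to the limit. *)
Lemma integral_exhaust_le (rho : T -> R) (m : R) (E : set T) (f : T -> \bar R)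
    (t : \bar R) :
  measurable E -> measurable_fun setT rho -> measurable_fun setT f ->
  (forall x, 0 <= f x) -> (forall x, E x -> (rho x <= m)%R) -> 0 <= t ->
  (forall y, E y -> \int[mu]_(x in E `&` [set x | (rho x <= rho y)%R]) f x <= t) ->
  \int[mu]_(x in E) f x <= t.
Proof.
move=> mE mrho mf f0 Em t0 H.
have [E0|/set0P[e Ee]] := eqVneq E set0; first by rewrite E0 integral_set0.
have [[y [Ey ymax]]|nomax] :=
    pselect (exists y, E y /\ forall x, E x -> (rho x <= rho y)%R).
  rewrite (_ : E = E `&` [set x | (rho x <= rho y)%R]); first exact: H.
  by apply/seteqP; split=> [x Ex|x []//]; split=> //; exact: ymax.
have hs : has_sup (rho @` E).
  by split; [exists (rho e), e|exists m => _ [x Ex <-]; exact: Em].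
set s := sup (rho @` E).
pose F n := E `&` [set x | (rho x <= s - n.+1%:R^-1)%R].
have mF n : measurable (F n).
  apply: measurableI => //; rewrite -[X in measurable X]setTI.
  by apply: measurable_fun_le.
have ltE x : E x -> (rho x < s)%R.
  move=> Ex; apply: contrapT => /negP; rewrite -leNgt => sx; apply: nomax.
  exists x; split => // y Ey; apply: le_trans sx.
  by apply: (sup_upper_bound hs); exists y.
have FE : E = \bigcup_n F n.
  apply/seteqP; split=> [x Ex|x [n _ []//]].
  have := ltE _ Ex; rewrite -subr_gt0 => sx.
  have n0 := Num.Theory.archi_boundP (ltW (divr_gt0 ltr01 sx)).
  exists (Num.bound (1 / (s - rho x))%R) => //; split => //=.
  rewrite lerBrDr -lerBrDl.
  rewrite -[leRHS]invrK lef_pV2 ?posrE ?invr_gt0//.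
  move: n0; rewrite div1r => /ltW/le_trans; apply.
  by rewrite ler_nat.
have IF n : \int[mu]_(x in F n) f x <= t.
  have [|_ [y Ey <-] sy] := @sup_adherent _ _ n.+1%:R^-1 _ hs.
    by rewrite invr_gt0.
  apply: le_trans (H _ Ey); apply: ge0_subset_integral => //.
  - apply: measurableI => //; rewrite -[X in measurable X]setTI.
    by apply: measurable_fun_le.
  - exact: measurable_funS mf.
  - by move=> x [Ex /= xs]; split => //=; rewrite (le_trans xs)// ltW.
have ndF : nondecreasing_seq F.
  apply/nondecreasing_seqP => n; apply/subsetPset => x [Ex /= xs]; split => //=.
  by rewrite (le_trans xs)// lerB// lef_pV2 ?posrE// ler_nat.
rewrite {1}FE.
have cv := ge0_nondecreasing_set_cvg_integral (mu := mu) ndF mF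
  (fun n => measurable_funS measurableT (@subsetT _ _) mf) (fun n x _ => f0 x).
rewrite -(cvg_lim _ cv)//; apply: lime_le; first by apply/cvg_ex; eexists; exact: cv.
by apply: nearW.
Qed.

End sublevel.

(** * Integrals of negative powers by level sets *)

Section level_sums.
Context {R : realType}.
Variables (al th M : R).
Hypotheses (al0 : 0 < al) (al1 : al < 1) (th0 : 0 < th) (th1 : th < 1)
  (M0 : 0 < M).

(* Increments of [t^(-al)] along the levels [th^k M]: the sum of the
   coefficients of the levels above [tau] dominates [tau^(-al)]. *)
Definition level_coef (k : nat) : R :=
  if k is k'.+1 then (th ^+ k.+1 * M) `^ (- al) - (th ^+ k * M) `^ (- al)
  else (th * M) `^ (- al).

Lemma level_coef_ge0 k : 0 <= level_coef k.
Proof.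
case: k => [|k] /=; first exact: powR_ge0.
have r0 : 0 < th ^+ k.+1 * M by rewrite mulr_gt0// exprn_gt0.
rewrite subr_ge0 [X in _ <= (X * _) `^ _]exprS -mulrA.
rewrite [leRHS]powRM ?(ltW th0) ?(ltW r0)// ler_peMl ?powR_ge0//.
rewrite powRN invf_ge1 ?powR_gt0// -[leRHS](powRr0 th).
by apply: ger_powR; rewrite ?th0 ?ltW.
Qed.

Lemma sum_level_coef n :
  \sum_(k < n.+1) level_coef k = (th ^+ n.+1 * M) `^ (- al).
Proof.
elim: n => [|n IH]; first by rewrite big_ord1 /= expr1.
by rewrite big_ord_recr IH /= addrC subrK.
Qed.

(** The concave power lies below its tangent at 1; this is Young's inequality with second factor
    1. *)
Lemma powR_le_line (b x : R) : 0 < b -> b < 1 -> 0 <= x ->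
  x `^ b <= 1 - b * (1 - x).
Proof.
move=> b0 b1 x0.
have c0 : 0 < 1 - b by rewrite subr_gt0.
have := @conjugate_powR _ (x `^ b) 1 b^-1 (1 - b)^-1 (powR_ge0 _ _) ler01.
rewrite !invr_gt0 !invrK => /(_ b0 c0); rewrite addrC subrK => /(_ erefl).
by rewrite -powRrM mulfV ?gt_eqF// powRr1// powR1 mulr1; lra.
Qed.

(** After Abel summation this is a Riemann sum of [t^(-al)], bounded by [int_0^M t^(-al) dt] up to
    the factor [th^(-al)]. In closed form it reduces to [(1 - al) (1 - th) <= 1 - th^(1-al)], the
    tangent inequality above. *)
Lemma sum_level_le n :
  \sum_(k < n) level_coef k * (th ^+ k * M)
    <= th `^ (- al) * (M `^ (1 - al) / (1 - al)).
Proof.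
set x := th `^ (1 - al); set t := th `^ (- al).
have x0 : 0 < x by rewrite powR_gt0.
have line : x <= 1 - (1 - al) * (1 - th).
  apply: powR_le_line; last exact: ltW.
    by rewrite subr_gt0.
  by rewrite gtrBl.
have tx : t * th = x.
  rewrite /t /x mulrC -{1}(powRr1 (ltW th0)) -powRD//.
    by apply/implyP => _; rewrite gt_eqF.
have t1 : 1 <= t.
  rewrite /t -[leLHS](powRr0 th); apply: ger_powR; rewrite ?th0 ?ltW//.
  by rewrite oppr_lt0.
have x1 : 0 < 1 - x.
  have : 0 < (1 - al) * (1 - th) by rewrite mulr_gt0// subr_gt0.
  lra.
(* Geometric series: the term of index 0 is [t M^(1-al)], the one of index [k >= 1] is
   [(t - 1) x^k M^(1-al)]. *)
have formula m : \sum_(k < m.+1) level_coef k * (th ^+ k * M) =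
    M `^ (1 - al) * ((t - x) - (t - 1) * x ^+ m.+1) / (1 - x).
  have Mal : M `^ (1 - al) = M * M `^ (- al).
    rewrite powRD ?powRr1 ?(ltW M0)//.
    by apply/implyP => _; rewrite gt_eqF.
  elim: m => [|m IH].
    rewrite big_ord1 /= expr0 mul1r expr1 Mal.
    rewrite powRM ?ltW// -/t; field.
    by rewrite gt_eqF.
  rewrite big_ord_recr IH /= Mal.
  have -> : (th ^+ m.+2 * M) `^ (- al) = t * (th ^+ m.+1 * M) `^ (- al).
    by rewrite exprS -mulrA powRM ?ltW// mulr_gt0// exprn_gt0.
  have -> : (th ^+ m.+1 * M) `^ (- al) = (th ^+ m.+1) `^ (- al) * M `^ (- al).
    by rewrite powRM ?ltW// exprn_gt0.
  have -> : (th ^+ m.+1) `^ (- al) = t ^+ m.+1.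
    rewrite -[in LHS](powR_mulrn m.+1 (ltW th0)).
    by rewrite -[RHS](powR_mulrn m.+1 (powR_ge0 _ _)) /t -!powRrM mulrC.
  have -> : x ^+ m.+2 = x * (t ^+ m.+1 * th ^+ m.+1).
    by rewrite -exprMn tx exprS.
  have -> : x ^+ m.+1 = t ^+ m.+1 * th ^+ m.+1 by rewrite -exprMn tx.
  by field; rewrite gt_eqF.
case: n => [|n].
  rewrite big_ord0 mulr_ge0 ?powR_ge0// divr_ge0 ?powR_ge0//.
  by rewrite subr_ge0 ltW.
rewrite formula -mulrA [leRHS]mulrCA ler_wpM2l ?powR_ge0//.
have al1' : 0 < 1 - al by rewrite subr_gt0.
rewrite ler_pdivrMr// mulrAC ler_pdivlMr//.
have xn : 0 <= (t - 1) * x ^+ n.+1.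
  by rewrite mulr_ge0 ?subr_ge0// exprn_ge0 ?ltW.
apply: (@le_trans _ _ ((t - x) * (1 - al))).
  by rewrite ler_wpM2r ?gerBl// ltW.
rewrite -tx; have -> : t - t * th = t * (1 - th) by ring.
rewrite -mulrA ler_wpM2l//; first by rewrite (le_trans _ t1).
by rewrite tx; lra.
Qed.

End level_sums.

Section negative_power.
Context {d : measure_display} {T : measurableType d} {R : realType}.
Variable mu : {measure set T -> \bar R}.
Variables (D : set T) (w : T -> \bar R) (tau : T -> R) (M al : R).
Hypotheses (mD : measurable D) (mw : measurable_fun setT w)
  (mtau : measurable_fun setT tau) (w0 : forall x, (0 <= w x)%E)
  (tau0 : forall x, D x -> 0 <= tau x) (tauM : forall x, D x -> tau x <= M)
  (al0 : 0 < al) (al1 : al < 1)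
  (level : forall t, 0 <= t ->
    (\int[mu]_(x in D `&` [set x | (tau x <= t)%R]) w x <= t%:E)%E).
Local Open Scope ereal_scope.

Let measurable_level (t : R) : measurable [set x | (tau x <= t)%R].
Proof. by rewrite -[X in measurable X]setTI; apply: measurable_fun_le. Qed.

Lemma measurable_powR_comp (r : R) (h : T -> R) : measurable_fun setT h ->
  measurable_fun setT (fun x => (h x `^ r)%:E).
Proof.
move=> mh; apply/measurable_EFinP.
exact: (measurableT_comp (measurable_powR r)).
Qed.

(** Discrete layer-cake formula: [tau^(-al)] is dominated pointwise by the sum of the [level_coef]
    of the levels above [tau], and [level] bounds the integral of [w] over each level set. *)
Lemma integral_powRN_le_approx (th : R) : (0 < M)%R -> (0 < th)%R -> (th < 1)%R ->
  \int[mu]_(x in D) (w x * (tau x `^ (- al))%:E)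
    <= (th `^ (- al) * (M `^ (1 - al) / (1 - al)))%:E.
Proof.
move=> M0 th0 th1.
pose c k := level_coef al th M k.
have c0 k : (0 <= c k)%R by exact: level_coef_ge0.
pose L k := [set x | (tau x <= th ^+ k * M)%R].
pose f k x := (c k)%:E * (\1_(L k) x)%:E * w x.
have f0 k x : 0 <= f k x by rewrite /f !mule_ge0 ?lee_fin.
have mL k : measurable (L k) by exact: measurable_level.
have mf k : measurable_fun setT (f k).
  apply: emeasurable_funM => //; apply: measurable_funeM.
  by apply/measurable_EFinP; exact: measurable_indic.
have Ifk k : \int[mu]_(x in D) f k x <= (c k * (th ^+ k * M))%:E.
  rewrite /f; under eq_integral do rewrite -muleA.
  rewrite ge0_integralZl_EFin//; last 2 first.
    by move=> x _; rewrite mule_ge0 ?lee_fin.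
    apply: emeasurable_funM; last exact: measurable_funS mw.
    by apply/measurable_EFinP; exact: measurable_indic.
  rewrite EFinM lee_wpmul2l ?lee_fin//.
  have -> : \int[mu]_(x in D) ((\1_(L k) x)%:E * w x) =
            \int[mu]_(x in D `&` L k) w x.
    rewrite integral_mkcondr; apply: eq_integral => x _.
    rewrite patchE indicE; case: (x \in L k); by rewrite ?mul1e ?mul0e.
  by apply: level; rewrite mulr_ge0 ?exprn_ge0 ?ltW.
apply: (@le_trans _ _ (\int[mu]_(x in D) \sum_(k <oo) f k x)).
  apply: ge0_le_integral => //.
  - by move=> x Dx; rewrite mule_ge0// lee_fin powR_ge0.
  - apply: emeasurable_funM; first exact: measurable_funS mw.
    by apply: measurable_funS (measurable_powR_comp _ mtau).
  - by apply: ge0_emeasurable_sum => // k _; exact: measurable_funS (mf k).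
  move=> x Dx.
  have [tx0|tx0] := eqVneq (tau x) 0%R.
    rewrite tx0 powR0 ?oppr_eq0 ?gt_eqF// mule0.
    by apply: nneseries_ge0.
  have {}tx0 : (0 < tau x)%R by rewrite lt_neqAle eq_sym tx0 tau0.
  have ex : exists n, (th ^+ n.+1 * M < tau x)%R.
    have cvg0 : (th ^+ n)%R @[n --> \oo] --> (0:R)%R.
      by apply: cvg_expr; rewrite ger0_norm ?ltW.
    have e0 : (0 < tau x / M)%R by rewrite divr_gt0.
    have [N _ HN] := cvgr0_norm_lt _ cvg0 _ e0.
    exists N; rewrite -ltr_pdivlMr//.
    by apply: le_lt_trans (HN N.+1 (leqnSn N)); exact: ler_norm.
  (* By minimality [th^(n+1) M < tau x <= th^n M], so [x] belongs to the levels [0..n], whose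
     coefficients telescope to [(th^(n+1) M)^(-al)]. *)
  case: (ex_minnP ex) => n nP nmin.
  have Lk k : (k <= n)%N -> L k x.
    case: k => [_|k kn]; first by rewrite /L/= expr0 mul1r; exact: tauM.
    rewrite /L /= leNgt; apply/negP => /nmin.
    by rewrite leqNgt kn.
  apply: (@le_trans _ _ (\sum_(k < n.+1) f k x)); last first.
    by rewrite -(big_mkord xpredT (f^~ x)); exact: nneseries_lim_ge.
  have -> : \sum_(k < n.+1) f k x = (\sum_(k < n.+1) c k)%:E * w x.
    rewrite -sumEFin ge0_sume_distrl; last by move=> k _; rewrite lee_fin.
    apply: eq_bigr => k _; rewrite /f indicE mem_set ?mule1//.
    by apply: Lk; rewrite -ltnS.
  rewrite muleC lee_wpmul2r// lee_fin sum_level_coef.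
  have r0 : (0 < th ^+ n.+1 * M)%R by rewrite mulr_gt0// exprn_gt0.
  rewrite !powRN lef_pV2 ?posrE ?powR_gt0//.
  by rewrite ge0_ler_powR ?nnegrE ?ltW.
rewrite integral_nneseries//; last by move=> k; exact: measurable_funS (mf k).
apply: lime_le; first by apply: is_cvg_nneseries => *; exact: integral_ge0.
apply: nearW => n.
apply: (@le_trans _ _ (\sum_(0 <= k < n) (c k * (th ^+ k * M))%:E)).
  by apply: lee_sum => k _.
by rewrite sumEFin lee_fin big_mkord; exact: sum_level_le.
Qed.

(* [level] says that [tau] is distributed under [w mu] no more singularly than
   Lebesgue measure, whence the bound by [int_0^M t^(-al) dt]. Where [tau]
   vanishes, [powR] makes the integrand [0]. *)
Lemma integral_powRN_le : (0 <= M)%R ->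
  \int[mu]_(x in D) (w x * (tau x `^ (- al))%:E)
    <= (M `^ (1 - al) / (1 - al))%:E.
Proof.
rewrite le_eqVlt => /predU1P[M0|M0].
  rewrite integral0_eq ?lee_fin ?divr_ge0 ?powR_ge0 ?subr_ge0 ?(ltW al1)//.
  move=> x Dx; have -> : tau x = 0%R.
    by apply/le_anti; rewrite tau0// M0 tauM.
  by rewrite powR0 ?mule0// oppr_eq0 gt_eqF.
set B := (M `^ (1 - al) / (1 - al))%R.
have B0 : (0 <= B)%R by rewrite divr_ge0 ?powR_ge0 ?subr_ge0 ?(ltW al1).
apply/lee_addgt0Pr => e e0.
(* With [th^(-al) = eta] the excess over [B] is [e B / (B + 1) <= e]. *)
pose eta := (1 + e / (B + 1))%R.
have B1 : (0 < B + 1)%R by rewrite ltr_wpDl.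
have eta1 : (1 < eta)%R by rewrite ltrDl divr_gt0.
have eta0 : (0 < eta)%R by rewrite (lt_trans _ eta1).
pose th := (eta `^ (- al^-1))%R.
have th0 : (0 < th)%R by rewrite powR_gt0.
have th1 : (th < 1)%R.
  rewrite /th powRN invf_lt1 ?powR_gt0//.
  have : (1 `^ al^-1 < eta `^ al^-1)%R.
    by rewrite gt0_ltr_powR ?invr_gt0 ?nnegrE// ltW.
  by rewrite powR1.
have := integral_powRN_le_approx M0 th0 th1 => /le_trans; apply.
rewrite -EFinD lee_fin -/B.
have -> : (th `^ (- al) = eta)%R.
  by rewrite /th -powRrM mulrNN mulVf ?gt_eqF// powRr1 ?ltW.
rewrite /eta mulrDl mul1r lerD2l mulrAC ler_pdivrMr//.
by rewrite ler_pM2l// lerDl.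
Qed.

End negative_power.

(** * Tonelli's theorem on a sigma-finite part *)

Section tonelli.
Context {d : measure_display} {T : measurableType d} {R : realType}.
Variable mu : {measure set T -> \bar R}.
Local Open Scope ereal_scope.

(* [mu] need not be sigma-finite: it suffices that both factors live on a
   countable union of sets of finite measure, to which [mu] is restricted. *)
Lemma tonelli_support (a b : T -> \bar R) (S : set (T * T)) (Y : (set T)^nat) :
  measurable_fun setT a -> measurable_fun setT b ->
  (forall x, 0 <= a x) -> (forall x, 0 <= b x) -> measurable S ->
  (forall n, measurable (Y n)) -> (forall n, mu (Y n) < +oo) ->
  (forall x, a x != 0 -> exists n, Y n x) ->
  (forall x, b x != 0 -> exists n, Y n x) ->
  \int[mu]_x (a x * \int[mu]_y (b y * (\1_S (x, y))%:E)) =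
  \int[mu]_y (b y * \int[mu]_x (a x * (\1_S (x, y))%:E)).
Proof.
move=> ma mb a0 b0 mS mY Yfin aY bY.
pose U := \bigcup_n Y n.
have mU : measurable U by exact: bigcup_measurable.
(* The complement of [U], null for the restricted measure, completes the cover by the [Y n]. *)
have sf : sigma_finite setT (mrestr mu mU).
  exists (fun n => if n is n'.+1 then Y n' else ~` U).
    apply/seteqP; split=> // x _.
    have [[n _ Yx]|Ux] := pselect (U x); first by exists n.+1.
    by exists 0%N.
  case=> [|n]; split; rewrite /mrestr.
  - exact: measurableC.
  - by rewrite setICl measure0.
  - exact: mY.
  - apply: le_lt_trans (Yfin n); apply: le_measure; rewrite ?inE//.
    exact: measurableI.
pose m : {sigma_finite_measure set T -> \bar R} :=
  HB.pack (mrestr mu mU) (isSFinite.Build _ _ _ (mrestr mu mU)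
    (sfinite_measure_sigma_finite sf))
    (isSigmaFinite.Build _ _ _ (mrestr mu mU) sf).
have mE (f : T -> \bar R) : measurable_fun setT f -> (forall x, 0 <= f x) ->
    (forall x, f x != 0 -> U x) -> \int[mu]_x f x = \int[m]_x f x.
  move=> mf f0 fU.
  have -> : \int[mu]_x f x = \int[mu]_(x in U) f x.
    rewrite [RHS]integral_mkcond; apply: eq_integral => x _.
    rewrite patchE; case: ifPn => // /negP xU; apply/eqP/negPn/negP => /fU Ux.
    by apply: xU; rewrite inE.
  have -> : \int[m]_x f x = \int[m]_(x in U) f x.
    rewrite [RHS]integral_mkcond; apply: eq_integral => x _.
    rewrite patchE; case: ifPn => // /negP xU; apply/eqP/negPn/negP => /fU Ux.
    by apply: xU; rewrite inE.
  by apply: eq_measure_integral => A mA AU /=; rewrite /mrestr setIidl.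
have mS1 : measurable_fun setT (fun z : T * T => (\1_S z)%:E : \bar R).
  by apply/measurable_EFinP; exact: measurable_indic.
have ma1 : measurable_fun setT (fun z : T * T => a z.1).
  exact: measurableT_comp.
have mb2 : measurable_fun setT (fun z : T * T => b z.2).
  exact: measurableT_comp.
pose F (z : T * T) := a z.1 * (b z.2 * (\1_S z)%:E).
have mF : measurable_fun setT F.
  by apply: emeasurable_funM => //; apply: emeasurable_funM.
have F0 z : 0 <= F z by rewrite /F !mule_ge0 ?lee_fin.
have mSx x : measurable_fun setT (fun y => (\1_S (x, y))%:E : \bar R).
  by apply: measurableT_comp mS1 _; exact: pair1_measurable.
have mSy y : measurable_fun setT (fun x => (\1_S (x, y))%:E : \bar R).
  by apply: measurableT_comp mS1 _; exact: pair2_measurable.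
have mbx x : measurable_fun setT (fun y => b y * (\1_S (x, y))%:E).
  by apply: emeasurable_funM.
have may y : measurable_fun setT (fun x => a x * (\1_S (x, y))%:E).
  by apply: emeasurable_funM.
have bx0 x y : 0 <= b y * (\1_S (x, y))%:E by rewrite mule_ge0 ?lee_fin.
have ay0 x y : 0 <= a x * (\1_S (x, y))%:E by rewrite mule_ge0 ?lee_fin.
have inner1 x : \int[mu]_y (b y * (\1_S (x, y))%:E) =
                \int[m]_y (b y * (\1_S (x, y))%:E).
  apply: mE => // y; apply: contraNP => Uy.
  by rewrite [b y](_ : _ = 0) ?mul0e//; apply/eqP/negPn/negP => /bY[n Yy]; apply: Uy; exists n.
have inner2 y : \int[mu]_x (a x * (\1_S (x, y))%:E) =
                \int[m]_x (a x * (\1_S (x, y))%:E).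
  apply: mE => // x; apply: contraNP => Ux.
  by rewrite [a x](_ : _ = 0) ?mul0e//; apply/eqP/negPn/negP => /aY[n Yy]; apply: Ux; exists n.
have in1E x : a x * \int[m]_y (b y * (\1_S (x, y))%:E) = \int[m]_y F (x, y).
  by rewrite /F/= ge0_integralZl.
have in2E y : b y * \int[m]_x (a x * (\1_S (x, y))%:E) = \int[m]_x F (x, y).
  rewrite -ge0_integralZl//; apply: eq_integral => x _.
  by rewrite /F /= muleCA.
under eq_integral do rewrite inner1 in1E.
under [RHS]eq_integral do rewrite inner2 in2E.
have FU x y : F (x, y) != 0 -> U x /\ U y.
  rewrite /F /= !mule_eq0 !negb_or => /and3P[/aY[n ?] /bY[k ?] _].
  by split; [exists n|exists k].
rewrite mE; last 3 first.
- exact: (measurable_fun_fubini_tonelli_F F).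
- by move=> x; exact: integral_ge0.
- move=> x; apply: contraNP => Ux; apply/eqP; apply: integral0_eq => y _.
  by apply/eqP/negPn/negP => /FU[].
rewrite [RHS]mE; last 3 first.
- exact: (measurable_fun_fubini_tonelli_G F).
- by move=> x; exact: integral_ge0.
- move=> y; apply: contraNP => Uy; apply/eqP; apply: integral0_eq => x _.
  by apply/eqP/negPn/negP => /FU[].
exact: fubini_tonelli.
Qed.

End tonelli.

(** * The weighted Hardy inequality *)

Lemma measurable_set_ltr {d} {T : measurableType d} {R : realType} (f g : T -> R) :
  measurable_fun setT f -> measurable_fun setT g ->
  measurable [set x | (f x < g x)%R].
Proof.
move=> mf mg; rewrite (_ : [set x | _] = ~` [set x | g x <= f x]).
  by apply: measurableC; rewrite -[X in measurable X]setTI;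
    exact: measurable_fun_le.
by apply/seteqP; split=> x /=; rewrite ltNge => /negP.
Qed.

Lemma measurable_poweR_comp {d} {T : measurableType d} {R : realType} (r : R)
    (h : T -> \bar R) : measurable_fun setT h ->
  measurable_fun setT (fun x => (h x `^ r)%E).
Proof.
move=> mh; apply: (@measurableT_comp _ _ _ _ _ _ (fun z => (z `^ r)%E) _ h) => //.
exact: measurable_poweR.
Qed.

Lemma measurable_fine_comp {d} {T : measurableType d} {R : realType}
    (h : T -> \bar R) : measurable_fun setT h ->
  measurable_fun setT (fun x => fine (h x)).
Proof. by move=> mh; apply: (@measurableT_comp _ _ _ _ _ _ (@fine R) _ h). Qed.

(** * Integrals over balls as functions of the radius *)

Section radial.
Context {d : measure_display} {T : measurableType d} {R : realType}.
Variable mu : {measure set T -> \bar R}.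
Variable rho : T -> R.
Hypothesis mrho : measurable_fun setT rho.
Local Open Scope ereal_scope.

Lemma measurable_ltset (r : R) : measurable [set y | (rho y < r)%R].
Proof. exact: measurable_set_ltr. Qed.

Lemma le_integral_ltset (f : T -> \bar R) (r s : R) : measurable_fun setT f ->
  (forall x, 0 <= f x) -> (r <= s)%R ->
  \int[mu]_(y in [set y | (rho y < r)%R]) f y <=
  \int[mu]_(y in [set y | (rho y < s)%R]) f y.
Proof.
move=> mf f0 rs; apply: ge0_subset_integral => //; try exact: measurable_ltset.
  exact: measurable_funS mf.
by move=> y /= /lt_le_trans; exact.
Qed.

Lemma ge_integral_geset (f : T -> \bar R) (r s : R) : measurable_fun setT f ->
  (forall x, 0 <= f x) -> (r <= s)%R ->
  \int[mu]_(y in ~` [set y | (rho y < s)%R]) f y <=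
  \int[mu]_(y in ~` [set y | (rho y < r)%R]) f y.
Proof.
move=> mf f0 rs; apply: ge0_subset_integral => //;
  try by apply: measurableC; exact: measurable_ltset.
  exact: measurable_funS mf.
by move=> y /= + yr; apply; exact: lt_le_trans rs.
Qed.

Lemma measurable_integral_ltset (f : T -> \bar R) : measurable_fun setT f ->
  (forall x, 0 <= f x) ->
  measurable_fun setT (fun x => \int[mu]_(y in [set y | (rho y < rho x)%R]) f y).
Proof.
move=> mf f0.
apply: (@measurableT_comp _ _ _ _ _ _
  (fun r => \int[mu]_(y in [set y | (rho y < r)%R]) f y) _ rho) => //.
by apply: nondecreasing_emeasurable => r s; exact: le_integral_ltset.
Qed.

Lemma measurable_integral_geset (f : T -> \bar R) : measurable_fun setT f ->
  (forall x, 0 <= f x) ->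
  measurable_fun setT
    (fun x => \int[mu]_(y in ~` [set y | (rho y < rho x)%R]) f y).
Proof.
move=> mf f0.
apply: (@measurableT_comp _ _ _ _ _ _
  (fun r => \int[mu]_(y in ~` [set y | (rho y < r)%R]) f y) _ rho) => //.
by apply: nonincreasing_emeasurable => r s; exact: ge_integral_geset.
Qed.

End radial.

(** Markov's inequality in qualitative form; it provides the sets of finite measure for
    [tonelli_support]. *)
Lemma measure_ge_lty {d} {T : measurableType d} {R : realType}
    (mu : {measure set T -> \bar R}) (A : set T) (f : T -> \bar R) (c : R) :
  measurable A -> measurable_fun setT f -> (0 < c)%R ->
  (forall x, A x -> c%:E <= f x)%E -> (\int[mu]_(x in A) f x < +oo)%E ->
  (mu A < +oo)%E.
Proof.
move=> mA mf c0 cf If.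
have : (c%:E * mu A < +oo)%E.
  rewrite -integral_cst//; apply: le_lt_trans If; apply: ge0_le_integral => //.
  - by move=> x _ /=; rewrite lee_fin ltW.
  - exact: measurable_funS mf.
by apply: contraTT; rewrite -!leNgt !leye_eq => /eqP ->; rewrite gt0_muley ?lte_fin.
Qed.

Section hardy.
Context {d : measure_display} {T : measurableType d} {R : realType}.
Variable mu : {measure set T -> \bar R}.
(** [k] stands for [f^q g^(1-q)], the usual right-hand integrand of Hardy's inequality. Expressing
    the relation through [fkg], where [k] and [g] are finite, avoids a negative power of [g], which
    may be 0 or [+oo]. *)
Variables (rho : T -> R) (w g k f : T -> \bar R) (q q' D : R).
Local Open Scope ereal_scope.
Let B x := [set y | (rho y < rho x)%R].
Let H x := \int[mu]_(y in B x) g y.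
Let W x := \int[mu]_(y in ~` B x) w y.
Hypotheses (mrho : measurable_fun setT rho) (rho0 : forall x, (0 <= rho x)%R)
  (mw : measurable_fun setT w) (mg : measurable_fun setT g)
  (mk : measurable_fun setT k) (mf : measurable_fun setT f)
  (w0 : forall x, 0 <= w x) (g0 : forall x, 0 <= g x)
  (k0 : forall x, 0 <= k x) (f0 : forall x, 0 <= f x)
  (q0 : (0 < q)%R) (q'0 : (0 < q')%R) (qq' : (q^-1 + q'^-1 = 1)%R)
  (D0 : (0 <= D)%R)
  (sphere_null : forall r : R, \int[mu]_(x in [set x | rho x = r]) g x < +oo ->
     \int[mu]_(x in [set x | rho x = r]) g x = 0)
  (muckenhoupt : forall x, W x `^ q^-1 * H x `^ q'^-1 <= D%:E)
  (fkg : forall x, k x < +oo -> g x < +oo ->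
     f x <= k x `^ q^-1 * g x `^ q'^-1)
  (Ik : \int[mu]_x k x < +oo).

Let mB x : measurable (B x). Proof. exact: measurable_ltset. Qed.
Let mBC x : measurable (~` B x). Proof. exact/measurableC/mB. Qed.
Let mH : measurable_fun setT H. Proof. exact: measurable_integral_ltset. Qed.
Let mW : measurable_fun setT W. Proof. exact: measurable_integral_geset. Qed.
Let H0 x : 0 <= H x. Proof. exact: integral_ge0. Qed.
Let W0 x : 0 <= W x. Proof. exact: integral_ge0. Qed.
Let qi0 : (0 < q^-1)%R. Proof. by rewrite invr_gt0. Qed.
Let q'i0 : (0 < q'^-1)%R. Proof. by rewrite invr_gt0. Qed.

(** Exhaustion along [- rho]: the points of [E] at least as far out as [y] lie in the complement of
    the open ball [B y], whose [w]-mass is [W y]. *)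
Let level_W (E : set T) (t : \bar R) : measurable E -> 0 <= t ->
  (forall x, E x -> W x <= t) -> \int[mu]_(x in E) w x <= t.
Proof.
move=> mE t0 Et.
apply: (@integral_exhaust_le _ _ _ mu (fun x => - rho x)%R 0%R) => //.
- by apply: measurableT_comp.
- by move=> x _; rewrite oppr_le0.
move=> y Ey; apply: le_trans (Et _ Ey).
apply: ge0_subset_integral => //.
- apply: measurableI => //; rewrite -[X in measurable X]setTI.
  by apply: measurable_fun_le => //; exact: measurableT_comp.
- exact: measurable_funS mw.
- by move=> x [_ /=]; rewrite lerN2 /B /= => yx; apply/negP; rewrite -leNgt.
Qed.

(** Here the exhaustion runs along [rho], and the open ball [B y] misses the sphere through [y];
    [sphere_null] closes this gap. The sphere has finite [g]-mass because it lies in [B x0]. *)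
Let level_H (E : set T) (t : \bar R) x0 : measurable E -> 0 <= t ->
  E `<=` B x0 -> H x0 < +oo ->
  (forall x, E x -> H x <= t) -> \int[mu]_(x in E) g x <= t.
Proof.
move=> mE t0 EB Hx0 Et.
apply: (@integral_exhaust_le _ _ _ mu rho (rho x0)) => //.
  by move=> x /EB /ltW.
move=> y Ey; apply: le_trans (Et _ Ey).
have mS : measurable [set x | rho x = rho y].
  by rewrite -[X in measurable X]setTI; exact: (mrho measurableT (measurable_set1 (rho y))).
have -> : H y = \int[mu]_(x in B y `|` [set x | rho x = rho y]) g x.
  rewrite ge0_integral_setU//; last 2 first.
  - exact: measurable_funS mg.
  - by apply/disj_setPS => x [/= + xy]; rewrite /B/= xy ltxx.
  rewrite sphere_null ?adde0//; apply: le_lt_trans Hx0.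
  apply: ge0_subset_integral => //; first exact: measurable_funS mg.
  by move=> x /=; rewrite /B/= => ->; exact: (EB _ Ey).
apply: ge0_subset_integral => //.
- apply: measurableI => //; rewrite -[X in measurable X]setTI.
  by apply: measurable_fun_le.
- exact: measurableU.
- exact: measurable_funS mg.
- by move=> x [_ /=]; rewrite le_eqVlt => /predU1P[->|]; [right|left].
Qed.

(** [a] and [b] are the weights left over once Hoelder's inequality and the Muckenhoupt bound have
    been applied. Where [W] is infinite, [fine] and [powR] make [a] vanish. *)
Let a x := w x * (fine (W x) `^ (- q'^-1))%:E.
Let b y := k y * H y `^ q'^-1.
Let S := [set z : T * T | (rho z.2 < rho z.1)%R].

Let a0 x : 0 <= a x. Proof. by rewrite mule_ge0// lee_fin powR_ge0. Qed.
Let b0 x : 0 <= b x. Proof. by rewrite mule_ge0// poweR_ge0. Qed.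

Let ma : measurable_fun setT a.
Proof.
apply: emeasurable_funM => //; apply: measurable_powR_comp.
exact: measurable_fine_comp.
Qed.

Let mb : measurable_fun setT b.
Proof. by apply: emeasurable_funM => //; exact: measurable_poweR_comp. Qed.

Let mS : measurable S.
Proof.
apply: measurable_set_ltr; exact: measurableT_comp.
Qed.

Let W_fin x y : W y < +oo -> ~ B y x -> W x \is a fin_num.
Proof.
move=> Wy yx; rewrite ge0_fin_numE//; apply: le_lt_trans Wy.
by apply: ge_integral_geset => //; rewrite leNgt; apply/negP.
Qed.

Let qi1 : (1 - q'^-1 = q^-1)%R. Proof. by rewrite -qq' addrK. Qed.
Let q'i1 : (1 - q^-1 = q'^-1)%R. Proof. by rewrite -qq' addrC addKr. Qed.

(** The integral of [w W^(-1/q')] outside [B y] is at most [q W(y)^(1/q)], and the Muckenhoupt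
    condition at [y] turns [W^(1/q) H^(1/q')] into [D]. *)
Let inner_le y : b y * \int[mu]_x (a x * (\1_S (x, y))%:E) <= (q * D)%:E * k y.
Proof.
have [Wy|Wy] := ltP (W y) +oo; last first.
  (* An infinite [W y] is compatible with a finite [D] only if [H y = 0], and then [b y = 0]. *)
  have Hy : H y = 0.
    apply: (@poweR_eq0_eq0 _ _ q'^-1) => //; apply: contrapT => /eqP Hy.
    have := muckenhoupt y; move: Wy; rewrite leye_eq => /eqP ->.
    by rewrite poweRyr ?gt_eqF// gt0_mulye ?leye_eq// lt0e Hy poweR_ge0.
  rewrite /b Hy poweR0r ?gt_eqF// mule0 mul0e mule_ge0// lee_fin.
  by rewrite mulr_ge0// ltW.
have aE : \int[mu]_x (a x * (\1_S (x, y))%:E) <= \int[mu]_(x in ~` B y) a x.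
  rewrite [leRHS]integral_mkcond; apply: ge0_le_integral => //.
  - by move=> x _; rewrite mule_ge0// lee_fin.
  - apply: emeasurable_funM => //; apply/measurable_EFinP.
    apply: (@measurableT_comp _ _ _ _ _ _ (\1_S : T * T -> R) _ (fun x => (x, y))).
      exact: measurable_indic.
    exact: pair2_measurable.
  - by apply/(measurable_restrictT _ (mBC y)).1; exact: measurable_funS ma.
  move=> x _; rewrite patchE indicE; case: ifPn => [_|/negP yx].
    by rewrite -[leRHS]mule1 lee_wpmul2l// lee_fin; case: (_ \in _).
  rewrite memNset ?mule0// /S /= => xy; apply: yx; rewrite inE /B /=.
  by apply/negP; rewrite -leNgt ltW.
have aW : \int[mu]_(x in ~` B y) a x <= (fine (W y) `^ q^-1 * q)%:E.
  rewrite -[X in (_ * X)%R]invrK -qi1; apply: integral_powRN_le => //.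
  - exact: measurable_fine_comp.
  - by move=> x _; exact: fine_ge0.
  - move=> x /= xy; apply: fine_le; rewrite ?(W_fin Wy)//.
      by rewrite /B /= ltxx.
    by apply: ge_integral_geset => //; rewrite leNgt; apply/negP.
  - by rewrite -subr_gt0 qi1.
  - move=> t t0; apply: level_W; rewrite ?lee_fin//.
      apply: measurableI => //; rewrite -[X in measurable X]setTI.
      by apply: measurable_fun_le => //; exact: measurable_fine_comp.
    by move=> x [xy /=]; rewrite -lee_fin fineK// (W_fin Wy).
  - exact: fine_ge0.
have Wyf : W y = (fine (W y))%:E.
  by rewrite fineK//; apply: (W_fin Wy); rewrite /B /= ltxx.
have := le_trans aE aW => /(lee_wpmul2l (b0 y)) /le_trans; apply.
rewrite /b !EFinM -poweR_EFin -Wyf -[leRHS]muleA.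
rewrite [leLHS](_ : _ = q%:E * (W y `^ q^-1 * H y `^ q'^-1 * k y)).
  by rewrite lee_wpmul2l ?lee_fin ?(ltW q0)// lee_wpmul2r.
rewrite muleC (muleC (W y `^ _) q%:E) -muleA; congr (_ * _).
by rewrite (muleC (k y)) muleA.
Qed.

Let ae_k : {ae mu, forall x, k x < +oo}.
Proof.
have := integral_lty_ae measurableT mk (fun x _ => k0 x) Ik.
by apply: filterS => x; exact.
Qed.

(** The case [t = 0] of [level_W]. It covers the points where [0^(-1/q') = 0] makes [a] vanish. *)
Let ae_w : {ae mu, forall x, W x = 0 -> w x = 0}.
Proof.
have mE : measurable [set x | W x <= 0].
  by rewrite -[X in measurable X]setTI; apply: measurable_lee.
have Iw : \int[mu]_(x in [set x | W x <= 0]) w x = 0.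
  by apply/le_anti; rewrite integral_ge0// level_W.
have := ae_eq0_integral0 mE (measurable_funS measurableT (@subsetT _ _) mw)
  (fun x _ => w0 x) Iw.
by apply: filterS => x + Wx; apply; rewrite /= Wx.
Qed.

Let integral_f_eq0 x : H x = 0 -> \int[mu]_(y in B x) f y = 0.
Proof.
move=> Hx.
have aeg := ae_eq0_integral0 (mB x)
  (measurable_funS measurableT (@subsetT _ _) mg) (fun x _ => g0 x) Hx.
rewrite -[RHS](integral0 mu (B x)); apply: ge0_ae_eq_integral => //.
  exact: measurable_funS mf.
move: aeg ae_k; apply: filterS2 => y gy ky By.
have := fkg ky; rewrite (gy By) poweR0r ?gt_eqF// mule0 => /(_ (ltry 0%R)) fy.
by apply/le_anti; rewrite fy f0.
Qed.

(** Hoelder's inequality for the factors [k H^(1/q')] and [g H^(-1/q)], whose powers of [H] cancel.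
    The second one integrates to at most [q' H(x)^(1/q')], because [level_H] controls the level sets
    of [H]. *)
Let f_le x : H x < +oo ->
  \int[mu]_(y in B x) f y <=
  (\int[mu]_(y in B x) b y) `^ q^-1 *
    ((fine (H x) `^ q'^-1 * q')%:E) `^ q'^-1.
Proof.
move=> Hx.
have Hf y : B x y -> H y = (fine (H y))%:E.
  move=> yx; rewrite fineK// ge0_fin_numE//; apply: le_lt_trans Hx.
  by apply: le_integral_ltset => //; exact: ltW.
have Hxf : H x = (fine (H x))%:E by rewrite fineK// ge0_fin_numE.
have mg' (E : set T) : measurable_fun E g by exact: measurable_funS mg.
have aeg := integral_lty_ae (mB x) (mg' _) (fun x _ => g0 x) Hx.
have mE : measurable (B x `&` [set y | H y <= 0]).
  apply: measurableI => //; rewrite -[X in measurable X]setTI.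
  by apply: measurable_lee.
have Ig : \int[mu]_(y in B x `&` [set y | H y <= 0]) g y = 0.
  apply/le_anti; rewrite integral_ge0// andbT.
  by apply: (level_H _ _ _ Hx) => // y [].
have aeg0 := ae_eq0_integral0 mE (mg' _) (fun x _ => g0 x) Ig.
pose c y := g y * (fine (H y) `^ (- q^-1))%:E.
have mc : measurable_fun setT c.
  apply: emeasurable_funM => //; apply: measurable_powR_comp.
  exact: measurable_fine_comp.
have c0 y : 0 <= c y by rewrite mule_ge0// lee_fin powR_ge0.
have Ic : \int[mu]_(y in B x) c y <= (fine (H x) `^ q'^-1 * q')%:E.
  rewrite -[X in (_ * X)%R]invrK -q'i1; apply: integral_powRN_le => //.
  - exact: measurable_fine_comp.
  - by move=> y _; exact: fine_ge0.
  - move=> y yx; rewrite -lee_fin -Hxf -(Hf _ yx).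
    by apply: le_integral_ltset => //; exact: ltW.
  - by rewrite -subr_gt0 q'i1.
  - move=> t t0; apply: (level_H _ _ _ Hx); rewrite ?lee_fin//.
      apply: measurableI => //; rewrite -[X in measurable X]setTI.
      by apply: measurable_fun_le => //; exact: measurable_fine_comp.
    by move=> y [yx /=]; rewrite -lee_fin -(Hf _ yx).
  - exact: fine_ge0.
apply: (@le_trans _ _ ((\int[mu]_(y in B x) b y) `^ q^-1 *
    (\int[mu]_(y in B x) c y) `^ q'^-1)); last first.
  rewrite lee_wpmul2l ?poweR_ge0// gt0_ler_poweR ?(ltW q'i0)//.
  - by rewrite in_itv/= leey andbT; exact: integral_ge0.
  - by rewrite in_itv/= leey andbT lee_fin mulr_ge0 ?powR_ge0 ?ltW.
apply: hoelder_ge0 => //; try exact: measurable_funS mf.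
- exact: measurable_funS mb.
- exact: measurable_funS mc.
near=> y => yx.
have ky : k y < +oo by near: y.
have gy : g y < +oo by move: yx; near: y.
apply: (le_trans (fkg ky gy)).
(* Where [H y = 0] the power [H^(-1/q)] degenerates to 0, but [g] vanishes a.e. there, and so does
   [f]. *)
have [Hy|Hy] := eqVneq (H y) 0.
  have gy0 : g y = 0.
    have : (B x `&` [set y | H y <= 0]) y by split => //=; rewrite Hy.
    by near: y.
  by rewrite gy0 poweR0r ?gt_eqF// mule0 mule_ge0 ?poweR_ge0.
have h0 : (0 < fine (H y))%R by rewrite fine_gt0// lt0e Hy H0 /= (Hf _ yx) ltry.
rewrite /b /c !poweRM ?poweR_ge0 ?lee_fin ?powR_ge0//.
rewrite [X in X `^ q'^-1 `^ _](Hf _ yx) !poweR_EFin muleACA.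
rewrite -EFinM -!powRrM -powRD; last by apply/implyP => _; rewrite gt_eqF.
by rewrite mulNr mulrC subrr powRr0 mule1.
Unshelve. all: by end_near. Qed.

(* The Schur-test proof of Opic-Kufner: Hoelder's inequality against the weight
   [H ^ (1/(q q'))], then Tonelli, each step costing one application of
   [integral_powRN_le]. *)
Lemma hardy_ineq :
  \int[mu]_x (w x * (\int[mu]_(y in B x) f y) `^ q) <=
  (q' `^ (q / q') * q * D `^ q)%:E * \int[mu]_x k x.
Proof.
(* [q'^(q/q')] comes from [f_le], and [D^(q/q')] from trading the power of [H] for one of [W]; the
   missing factor [q D] is that of [inner_le]. *)
set C0 := (q' `^ (q / q') * D `^ (q / q'))%R.
have C00 : (0 <= C0)%R by rewrite mulr_ge0 ?powR_ge0.
have qq1 : (q / q' + 1 = q)%R.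
  by rewrite -q'i1 mulrBr mulr1 mulfV ?gt_eqF// subrK.
have IbE x : \int[mu]_y (b y * (\1_S (x, y))%:E) = \int[mu]_(y in B x) b y.
  rewrite [RHS]integral_mkcond; apply: eq_integral => y _.
  rewrite patchE indicE.
  have -> : ((x, y) \in S) = (y \in B x) by apply/idP/idP; rewrite !inE.
  by case: ifP => _; rewrite ?mule1 ?mule0.
have pointwise : {ae mu, forall x, w x * (\int[mu]_(y in B x) f y) `^ q <=
    C0%:E * (a x * \int[mu]_y (b y * (\1_S (x, y))%:E))}.
  move: ae_w; apply: filterS => x Ww; rewrite IbE.
  have Ib0 : 0 <= \int[mu]_(y in B x) b y by exact: integral_ge0.
  have [Wx|Wx] := eqVneq (W x) 0.
    by rewrite (Ww Wx) mul0e mule_ge0 ?lee_fin// mule_ge0.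
  have [Hx|Hx] := eqVneq (H x) 0.
    rewrite (integral_f_eq0 Hx) poweR0r ?gt_eqF// mule0.
    by rewrite mule_ge0 ?lee_fin// mule_ge0.
  have Wx0 : 0 < W x by rewrite lt0e Wx W0.
  have Hx0 : 0 < H x by rewrite lt0e Hx H0.
  have [Wy|Wy] := eqVneq (W x) +oo.
    have := muckenhoupt x.
    by rewrite Wy poweRyr ?gt_eqF// gt0_mulye ?poweR_gt0// leye_eq.
  have [Hy|Hy] := eqVneq (H x) +oo.
    have := muckenhoupt x.
    by rewrite Hy poweRyr ?gt_eqF// gt0_muley ?poweR_gt0// leye_eq.
  have Wxf : W x = (fine (W x))%:E.
    by rewrite fineK// ge0_fin_numE// ltey.
  have Hxf : H x = (fine (H x))%:E.
    by rewrite fineK// ge0_fin_numE// ltey.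
  set W1 := fine (W x) in Wxf; set H1 := fine (H x) in Hxf.
  move: Wx0 Hx0; rewrite Wxf Hxf !lte_fin => W10 H10.
  have := muckenhoupt x; rewrite Wxf Hxf !poweR_EFin -EFinM lee_fin => WHD.
  have Hlt : H x < +oo by rewrite Hxf ltry.
  have := f_le Hlt; rewrite -/H1 => fle.
  apply: (@le_trans _ _ (w x * ((\int[mu]_(y in B x) b y) `^ q^-1 *
      ((H1 `^ q'^-1 * q')%:E) `^ q'^-1) `^ q)).
    rewrite lee_wpmul2l// gt0_ler_poweR ?(ltW q0)//.
    - by rewrite in_itv/= leey andbT; exact: integral_ge0.
    - by rewrite in_itv/= leey andbT mule_ge0 ?poweR_ge0 ?lee_fin ?powR_ge0.
  rewrite poweRM ?poweR_ge0// -!poweRrM mulVf ?gt_eqF// poweRe1// poweR_EFin.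
  rewrite [leRHS](_ : _ = w x * (\int[mu]_(y in B x) b y *
      (C0 * W1 `^ (- q'^-1))%:E)); last first.
    rewrite /a -/W1 EFinM !muleA; rewrite [in RHS]muleAC; congr (_ * _).
    by rewrite -muleA muleC -!muleA; congr (_ * _); rewrite muleC.
  rewrite !lee_wpmul2l// lee_fin.
  have -> : (q'^-1 * q = q / q')%R by rewrite mulrC.
  rewrite powRM ?powR_ge0 ?(ltW q'0)// mulrC /C0 -mulrA ler_wpM2l ?powR_ge0//.
  (* The Muckenhoupt bound solved for [H]; its power [q/q'] leaves exactly the [W^(-1/q')] contained
     in [a]. *)
  have : (H1 `^ q'^-1 <= D * W1 `^ (- q^-1))%R.
    rewrite powRN ler_pdivlMr; last exact: powR_gt0.
    by rewrite mulrC; exact: WHD.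
  move/(ge0_ler_powR (ltW (divr_gt0 q0 q'0))).
  rewrite !nnegrE mulr_ge0 ?powR_ge0// => /(_ isT isT).
  rewrite [X in (_ <= X)%R]powRM ?powR_ge0// -[X in (_ <= _ * X)%R]powRrM.
  by rewrite mulNr mulrA mulVf ?gt_eqF// mul1r.
have mIf : measurable_fun setT (fun x => \int[mu]_(y in B x) f y).
  exact: measurable_integral_ltset.
have mIb : measurable_fun setT (fun x => \int[mu]_(y in B x) b y).
  exact: measurable_integral_ltset.
apply: (@le_trans _ _ (\int[mu]_x (C0%:E * (a x * \int[mu]_y (b y * (\1_S (x, y))%:E))))).
  apply: ae_ge0_le_integral => //.
  - by move=> x _; rewrite mule_ge0 ?poweR_ge0.
  - apply: emeasurable_funM => //.
    exact: measurable_poweR_comp.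
  - move=> x _; rewrite IbE; apply: mule_ge0; first by rewrite lee_fin.
    by apply: mule_ge0 => //; exact: integral_ge0.
  - under eq_fun do rewrite IbE.
    by apply: measurable_funeM; apply: emeasurable_funM.
  by move: pointwise; apply: filterS.
rewrite ge0_integralZl_EFin//; last 2 first.
- by move=> x _; rewrite IbE mule_ge0//; exact: integral_ge0.
- by under eq_fun do rewrite IbE; apply: emeasurable_funM.
(* These sets cover the supports of [a] and [b]. They have finite measure because [k] is integrable
   and [level_W] bounds the [w]-mass of [W <= n]. *)
pose Y n := [set x | n.+1%:R^-1%:E <= k x] `|`
  ([set x | n.+1%:R^-1%:E <= w x] `&` [set x | W x <= n%:R%:E]).
have mle (h1 h2 : T -> \bar R) : measurable_fun setT h1 ->
    measurable_fun setT h2 -> measurable [set x | h1 x <= h2 x].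
  by move=> m1 m2; rewrite -[X in measurable X]setTI; exact: measurable_lee.
have archi (h : \bar R) : 0 < h -> exists n, forall m, (n <= m)%N -> m.+1%:R^-1%:E <= h.
  case: h => [h| |]// h0; last by exists 0%N => m _; rewrite leey.
  rewrite lte_fin in h0; exists (Num.bound h^-1) => m hm; rewrite lee_fin.
  rewrite -[leRHS]invrK lef_pV2 ?posrE ?invr_gt0//.
  have hi : (0 <= h^-1)%R by rewrite invr_ge0 ltW.
  have /ltW/le_trans := archi_boundP hi; apply.
  by rewrite ler_nat (leq_trans hm).
rewrite (@tonelli_support _ _ _ mu a b S Y) //.
- have DE : (D `^ q = D `^ (q / q') * D)%R.
    rewrite -[X in (_ `^ X)%R = _]qq1 powRD ?powRr1//.
    by apply/implyP; rewrite qq1 gt_eqF.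
  have -> : (q' `^ (q / q') * q * D `^ q)%:E = C0%:E * (q * D)%:E.
    by rewrite -EFinM; congr (_%:E); rewrite /C0 DE; ring.
  rewrite -muleA lee_wpmul2l ?lee_fin// -ge0_integralZl_EFin//; last first.
    by rewrite mulr_ge0// ltW.
  apply: ge0_le_integral_nonmeasurable => y //.
  rewrite mule_ge0// integral_ge0// => x _; rewrite mule_ge0// lee_fin//.
- move=> n; apply: measurableU; first exact: mle.
  by apply: measurableI; exact: mle.
- move=> n; apply: (@le_lt_trans _ _ (mu [set x | n.+1%:R^-1%:E <= k x] +
    mu ([set x | n.+1%:R^-1%:E <= w x] `&` [set x | W x <= n%:R%:E]))).
    apply: measureU2; first exact: mle.
    by apply: measurableI; exact: mle.
  rewrite lte_add_pinfty//.
    apply: (@measure_ge_lty _ _ _ _ _ k n.+1%:R^-1) => //; first exact: mle.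
    apply: le_lt_trans Ik; apply: ge0_subset_integral => //; exact: mle.
  apply: (@measure_ge_lty _ _ _ _ _ w n.+1%:R^-1) => //.
  - by apply: measurableI; exact: mle.
  - by move=> x [].
  apply: (@le_lt_trans _ _ n%:R%:E); last exact: ltry.
  apply: level_W => //; last by move=> x [].
  by apply: measurableI; exact: mle.
- move=> x ax.
  have wx : 0 < w x.
    by rewrite lt0e w0 andbT; apply: contraNneq ax => wx; rewrite /a wx mul0e.
  have [n0 n0P] := archi _ wx.
  have Wy : W x < +oo.
    rewrite ltey; apply: contraNneq ax => Wx.
    by rewrite /a Wx /= powR0 ?mule0// oppr_eq0 gt_eqF.
  have WE : W x = (fine (W x))%:E by rewrite fineK// ge0_fin_numE.
  exists (maxn n0 (Num.bound (fine (W x)))); right; split => /=.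
    by apply: n0P; rewrite leq_maxl.
  rewrite WE lee_fin.
  have /ltW/le_trans := archi_boundP (fine_ge0 (W0 x)); apply.
  by rewrite ler_nat leq_maxr.
- move=> x bx.
  have kx : 0 < k x.
    by rewrite lt0e k0 andbT; apply: contraNneq bx => kx; rewrite /b kx mul0e.
  by have [n0 n0P] := archi _ kx; exists n0; left; exact: n0P.
Qed.

End hardy.

(** * Polar decomposition and logarithmic Hoelder inequality *)

Section fine_integrals.
Context {dX : measure_display} {X : measurableType dX} {R : realType}.
Variable mu : {measure set X -> \bar R}.
Local Open Scope ereal_scope.

Lemma ge0_integral_fine (D : set X) (f : X -> \bar R) : measurable D ->
  measurable_fun setT f -> (forall x, 0 <= f x) ->
  \int[mu]_(x in D) f x < +oo ->
  \int[mu]_(x in D) (fine (f x))%:E = \int[mu]_(x in D) f x.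
Proof.
move=> mD mf f0 If.
have mfD : measurable_fun D f by exact: measurable_funS mf.
apply: ge0_ae_eq_integral => //.
- apply/measurable_EFinP; apply: (measurable_funS measurableT) => //.
  exact: measurable_fine_comp.
- by move=> x _; rewrite lee_fin fine_ge0.
apply: filterS (integral_lty_ae mD mfD (fun x _ => f0 x) If) => x fx Dx.
by rewrite fineK// ge0_fin_numE// fx.
Qed.

(** In the polar formula for [g] times the indicator of the sphere, the inner integral vanishes for
    every radius other than [r], and a single radius is Lebesgue null. Finiteness of the mass makes
    the formula applicable. *)
Lemma polar_sphere_null (d : X -> X -> R) (a : X) (g : X -> \bar R) (r : R) :
  polar_decomposition mu d a -> measurable_fun setT (d a) ->
  measurable_fun setT g -> (forall x, 0 <= g x) ->
  \int[mu]_(x in [set x | d a x = r]) g x < +oo ->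
  \int[mu]_(x in [set x | d a x = r]) g x = 0.
Proof.
move=> [lambda [omega polar]] md mg g0 Ig.
set S := [set x | d a x = r] in Ig *.
have mS : measurable S.
  rewrite -[X in measurable X]setTI.
  exact: (md measurableT _ (measurable_set1 r)).
pose f x := (fine (g x) * \1_S x)%R.
have fE : \int[mu]_x (f x)%:E = \int[mu]_(x in S) g x.
  rewrite -(ge0_integral_fine mS mg g0 Ig) [RHS]integral_mkcond.
  apply: eq_integral => x _; rewrite /f patchE indicE.
  by case: (x \in S); rewrite ?mulr1 ?mulr0.
have f0 x : (0 <= f x)%R by rewrite mulr_ge0// fine_ge0.
have intf : mu.-integrable setT (fun x => (f x)%:E).
  apply/integrableP; split.
    apply/measurable_EFinP; apply: measurable_funM.
      exact: measurable_fine_comp.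
    exact: measurable_indic.
  by under eq_integral do rewrite gee0_abs ?lee_fin//; rewrite fE.
rewrite -fE polar//.
set h := (fun r0 => \int[omega r0]_(w in sphere d a r0) (f w * lambda r0 w)%:E).
have h0 t : t != r -> h t = 0.
  move=> tr; apply: integral0_eq => w; rewrite /sphere /= => wt.
  rewrite /f indicE memNset ?mulr0 ?mul0r// /S /= => wr.
  by move: tr; rewrite -wt wr eqxx.
(* Away from [r] the function [h] is 0, which also provides its measurability there. *)
rewrite -(@integral_setD1 _ h r); [|exact: measurableD|].
  by apply: integral0_eq => t [_ /= /eqP]; exact: h0.
apply: (eq_measurable_fun (cst 0)) => [t|]; last exact: measurable_cst.
by rewrite inE => -[_ /= /eqP /h0 ->].
Qed.

(** Positive and negative parts are compared separately. This admits the entropy integrand, which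
    may have an infinite negative part. *)
Lemma le_integral_no_integrability (f g : X -> \bar R) :
  measurable_fun setT f -> measurable_fun setT g ->
  (forall x, f x <= g x) -> \int[mu]_x f x <= \int[mu]_x g x.
Proof.
move=> mf mg fg; rewrite integralE [leRHS]integralE; apply: leeB.
  apply: ge0_le_integral => //; try exact: measurable_funepos.
  by move=> x _; rewrite !funeposE ge_max le_max fg/= le_max lexx orbT.
apply: ge0_le_integral => //; try exact: measurable_funeneg.
by move=> x _; rewrite !funenegE ge_max !le_max leeN2 fg/= lexx orbT.
Qed.

(* Jensen's inequality for [ln] under the probability density [F], through the
   tangent line [ln x <= x / c - 1 + ln c] at [c = int F ^ (1 + b)]. *)
Lemma entropy_le (F : X -> R) (b c : R) : measurable_fun setT F ->
  (forall x, 0 <= F x)%R -> (0 < b)%R -> (0 < c)%R ->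
  \int[mu]_x (F x)%:E = 1 -> \int[mu]_x (F x `^ (1 + b))%:E = c%:E ->
  \int[mu]_x (F x * ln (F x))%:E <= (b^-1 * ln c)%:E.
Proof.
move=> mF F0 b0 c0 F1 Fc.
have bi0 : (0 < b^-1)%R by rewrite invr_gt0.
pose g1 x := (b^-1 * c^-1)%:E * (F x `^ (1 + b))%:E.
pose g2 x := (b^-1 * (ln c - 1))%:E * (F x)%:E.
have mFb : measurable_fun setT (fun x => (F x `^ (1 + b))%:E).
  exact: measurable_powR_comp.
have iF : mu.-integrable setT (fun x => (F x)%:E).
  apply/integrableP; split; first exact/measurable_EFinP.
  by under eq_integral do rewrite gee0_abs ?lee_fin//; rewrite F1 ltry.
have iFb : mu.-integrable setT (fun x => (F x `^ (1 + b))%:E).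
  apply/integrableP; split=> //.
  by under eq_integral do rewrite gee0_abs ?lee_fin ?powR_ge0//; rewrite Fc ltry.
have ig1 : mu.-integrable setT g1 by exact: integrableZl.
have ig2 : mu.-integrable setT g2 by exact: integrableZl.
apply: (@le_trans _ _ (\int[mu]_x (g1 x + g2 x))).
  apply: le_integral_no_integrability.
  - apply/measurable_EFinP; apply: measurable_funM => //.
    exact: measurableT_comp.
  - by apply: emeasurable_funD; [case/integrableP: ig1|case/integrableP: ig2].
  move=> x; rewrite /g1 /g2 -!EFinM -EFinD lee_fin.
  have [Fx|Fx] := eqVneq (F x) 0%R.
    by rewrite Fx !mulr0 mul0r addr0 !mulr_ge0 ?invr_ge0 ?powR_ge0 ?ltW.
  have {}Fx : (0 < F x)%R by rewrite lt_neqAle eq_sym Fx F0.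
  have bne : (1 + b == 0)%R ==> (F x != 0)%R by apply/implyP => _; rewrite gt_eqF.
  rewrite powRD// powRr1//.
  have Fb : (0 < F x `^ b)%R by rewrite powR_gt0.
  have lnF : (b * ln (F x) <= F x `^ b / c - 1 + ln c)%R.
    rewrite -ln_powR -lerBlDr -ln_div ?posrE//.
    have Fbc : (0 < F x `^ b / c)%R by rewrite divr_gt0.
    have := @le_ln1Dx _ (F x `^ b / c - 1)%R.
    have -> : (1 + (F x `^ b / c - 1) = F x `^ b / c)%R by rewrite addrC subrK.
    by apply; rewrite ltrBrDr addNr.
  have -> : (b^-1 / c * (F x * F x `^ b) + b^-1 * (ln c - 1) * F x =
      F x * (b^-1 * (F x `^ b / c - 1 + ln c)))%R by ring.
  by rewrite ler_pM2l// ler_pdivlMl.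
rewrite integralD// !integralZl// F1 Fc mule1 -EFinM -EFinD lee_fin.
by rewrite mulrVK ?unitfE ?gt_eqF// mulrBr mulr1 addrC subrK.
Qed.

(** [entropy_le] for the density [G^p / P] with [b = (q - p) / p], so that [1 + b = q / p] and
    [c = P^(-q/p) Q]. *)
Lemma log_hoelder (G : X -> \bar R) (p q P Q : R) : measurable_fun setT G ->
  (forall x, 0 <= G x) -> (0 < p)%R -> (p < q)%R -> (0 < P)%R -> (0 < Q)%R ->
  \int[mu]_x G x `^ p = P%:E -> \int[mu]_x G x `^ q = Q%:E ->
  \int[mu]_x (fine (G x `^ p) / P * ln (fine (G x `^ p) / P))%:E <=
    (q / (q - p) * ln (Q `^ (p / q) / P))%:E.
Proof.
move=> mG G0 p0 pq P0 Q0 GP GQ.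
have q0 : (0 < q)%R by exact: lt_trans pq.
have qp0 : (0 < q - p)%R by rewrite subr_gt0.
pose F x := (fine (G x `^ p) / P)%R.
have mGp : measurable_fun setT (fun x => fine (G x `^ p)).
  exact/measurable_fine_comp/measurable_poweR_comp.
have mF : measurable_fun setT F by exact: measurable_funM.
have F0 x : (0 <= F x)%R by rewrite divr_ge0 ?fine_ge0 ?poweR_ge0 ?ltW.
have F1 : \int[mu]_x (F x)%:E = 1.
  rewrite /F; under eq_integral do rewrite mulrC EFinM.
  rewrite ge0_integralZl_EFin ?invr_ge0 ?(ltW P0)//; last 2 first.
  - by move=> x _; rewrite lee_fin fine_ge0 ?poweR_ge0.
  - exact/measurable_EFinP.
  rewrite ge0_integral_fine ?GP ?ltry//; last 2 first.
  - exact: measurable_poweR_comp.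
  - by move=> x; exact: poweR_ge0.
  by rewrite -EFinM mulVf ?gt_eqF.
have Fc : \int[mu]_x (F x `^ (1 + (q - p) / p))%:E = (P `^ (- (q / p)) * Q)%:E.
  have -> : (1 + (q - p) / p = q / p)%R by field; rewrite gt_eqF.
  transitivity (\int[mu]_x ((P `^ (- (q / p)))%:E * (fine (G x `^ q))%:E)).
    apply: eq_integral => x _; rewrite -EFinM; congr (_%:E).
    rewrite /F powRM ?fine_ge0 ?poweR_ge0 ?invr_ge0 ?(ltW P0)// mulrC.
    congr (_ * _)%R.
      by rewrite -(powR_inv1 (ltW P0)) -powRrM mulN1r.
    rewrite !fine_poweR -powRrM; congr (_ `^ _)%R.
    by field; rewrite gt_eqF.
  rewrite ge0_integralZl_EFin ?powR_ge0//; last 2 first.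
  - by move=> x _; rewrite lee_fin fine_ge0 ?poweR_ge0.
  - exact/measurable_EFinP/measurable_fine_comp/measurable_poweR_comp.
  rewrite ge0_integral_fine ?GQ ?ltry//.
  - exact: measurable_poweR_comp.
  - by move=> x; exact: poweR_ge0.
have b0 : (0 < (q - p) / p)%R by rewrite divr_gt0.
have c0 : (0 < P `^ (- (q / p)) * Q)%R by rewrite mulr_gt0 ?powR_gt0.
have := entropy_le mF F0 b0 c0 F1 Fc; rewrite /F => /le_trans; apply.
rewrite lee_fin lnM ?posrE ?powR_gt0// ln_div ?posrE ?powR_gt0//.
rewrite !ln_powR le_eqVlt; apply/orP; left; apply/eqP.
by field; rewrite !gt_eqF.
Qed.

End fine_integrals.

(** * The weights of the theorem *)

Section epow_facts.
Context {R : realType}.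
Local Open Scope ereal_scope.
Implicit Types (x y : \bar R) (r : R).

(** The sign of [r] matters: at a negative exponent [epow] sends 0 to [+oo], while [powR] sends it
    to 0. *)
Lemma epow_poweR x r : (0 < r)%R -> epow x r = x `^ r.
Proof.
move=> r0; have rn0 : (r == 0%R) = false by rewrite gt_eqF.
have rl0 : (r < 0)%R = false by rewrite ltNge ltW.
case: x => [x| |] /=; rewrite ?rl0 ?rn0 //.
by case: eqP => [->|//]; rewrite powR0 ?rn0.
Qed.

Lemma epow_EFin (x r : R) : (0 < x)%R -> epow x%:E r = (x `^ r)%:E.
Proof. by move=> x0; rewrite /= gt_eqF. Qed.

Lemma epow0N r : (r < 0)%R -> epow 0 r = +oo :> \bar R.
Proof. by move=> r0; rewrite /= eqxx r0. Qed.

Lemma epow_ge0 x r : 0 <= epow x r.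
Proof.
case: x => [x| |] //=; last by do 2 case: ifP => // _.
by case: ifP => _; [do 2 case: ifP => // _|rewrite lee_fin powR_ge0].
Qed.

Lemma einv_EFin (x : R) : (0 < x)%R -> einv x%:E = (x^-1)%:E.
Proof. by move=> x0; rewrite /einv epow_EFin// powR_inv1 ?ltW. Qed.

Lemma einv0 : einv 0 = +oo :> \bar R.
Proof. by rewrite /einv epow0N ?ltrN10. Qed.

Lemma einv_ge0 x : 0 <= einv x.
Proof. exact: epow_ge0. Qed.

Lemma measurable_epow r : measurable_fun setT (epow ^~ r : \bar R -> \bar R).
Proof.
have -> : epow ^~ r = fun x : \bar R =>
    if x == 0 then epow 0 r else if x == +oo then epow +oo r
    else if x == -oo then 0 else (fine x `^ r)%:E.
  apply/funext => -[x| |] //=; rewrite eqe eqxx.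
  by case: (x == 0%R).
apply: measurable_fun_ifT => //=; first exact: measurable_fun_eqe.
apply: measurable_fun_ifT => //=; first exact: measurable_fun_eqe.
apply: measurable_fun_ifT => //=; first exact: measurable_fun_eqe.
exact: measurable_powR_comp.
Qed.

Lemma measurable_epow_comp {d} {T : measurableType d} r (h : T -> \bar R) :
  measurable_fun setT h -> measurable_fun setT (fun w => epow (h w) r).
Proof.
move=> mh; apply: (@measurableT_comp _ _ _ _ _ _ (epow ^~ r) _ h) => //.
exact: measurable_epow.
Qed.

Lemma mule_fin_pos x y : 0 <= x -> 0 <= y -> 0 < x * y -> x * y < +oo ->
  [/\ 0 < x, x < +oo, 0 < y & y < +oo].
Proof.
move=> x0 y0 xy0; have := gt_eqF xy0; move/negbT; rewrite mule_eq0 negb_or => /andP[xn0 yn0].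
have xp : 0 < x by rewrite lt0e xn0.
have yp : 0 < y by rewrite lt0e yn0.
move=> xy; split=> //; rewrite ltey; apply: contraTneq xy => ->.
  by rewrite gt0_mulye ?ltxx.
by rewrite gt0_muley ?ltxx.
Qed.

Lemma epow_fin_pos x r : (r != 0)%R -> 0 <= x -> 0 < epow x r ->
  epow x r < +oo -> exists2 x' : R, (0 < x')%R & x = x'%:E.
Proof.
move=> r0; case: x => [x| |] //=.
  rewrite lee_fin le_eqVlt => /predU1P[<-|x0 _ _]; last by exists x.
  by rewrite eqxx (negbTE r0); case: ifP; rewrite ltxx.
by rewrite (negbTE r0); case: ifP; rewrite ltxx.
Qed.

(** Convexity of the power at [x / t] and [y / (1 - t)]. The factor of [x^q] tends to 1 as [t] tends
    to 1, which leaves room for absorption. *)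
Lemma powR_convex_split (t x y q : R) : (0 < t)%R -> (t < 1)%R ->
  (0 <= x)%R -> (0 <= y)%R -> (1 <= q)%R ->
  ((x + y) `^ q <= t `^ (1 - q) * x `^ q + (1 - t) `^ (1 - q) * y `^ q)%R.
Proof.
move=> t0 t1 x0 y0 q1.
have s0 : (0 < 1 - t)%R by rewrite subr_gt0.
have q0 : q != 0%R by rewrite gt_eqF// (lt_le_trans ltr01).
have powE (c w : R) : (0 < c)%R -> (0 <= w)%R ->
    (c * (w / c) `^ q = c `^ (1 - q) * w `^ q)%R.
  move=> c0 w0; rewrite powRM ?invr_ge0 ?(ltW c0)// powRB; last first.
    by apply/implyP => _; rewrite gt_eqF.
  rewrite powRr1 ?(ltW c0)// -powR_inv1 ?(ltW c0)// -powRrM mulN1r powRN.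
  by rewrite mulrCA mulrC.
rewrite -!powE//.
pose ti : {i01 R} := @Itv01 R t (ltW t0) (ltW t1).
have := @convex_powR R q q1 ti (x / t)%R (y / (1 - t))%R.
rewrite !inE/= !in_itv/= !andbT !divr_ge0 ?(ltW t0) ?(ltW s0)//.
move=> /(_ isT isT); rewrite convRE [X in (X `^ _ <= _)%R -> _]convRE /= /unstable.onem.
have -> : (t * (x / t) + (1 - t) * (y / (1 - t)) = x + y)%R.
  by field; rewrite !gt_eqF.
by [].
Qed.

End epow_facts.

(** [h] is replaced by the positive part of [f - g] divided by [c]: it is measurable, lies below
    [h], and still fills the gap between [f] and [g]. *)
Lemma le_integral_add_nonmeasurable {d} {T : measurableType d} {R : realType}
    (mu : {measure set T -> \bar R}) (f g h : T -> \bar R) (c : R) :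
  measurable_fun setT f -> measurable_fun setT g ->
  (forall x, 0 <= f x)%E -> (forall x, 0 <= g x)%E -> (forall x, 0 <= h x)%E ->
  0 < c -> (forall x, f x <= g x + c%:E * h x)%E ->
  (\int[mu]_x f x <= \int[mu]_x g x + c%:E * \int[mu]_x h x)%E.
Proof.
move=> mf mg f0 g0 h0 c0 fgh.
have ci0 : (0 <= c^-1)%R by rewrite invr_ge0 ltW.
pose e : T -> \bar R := ((fun x => f x - g x)^\+)%E.
have me : measurable_fun setT e by apply: measurable_funepos; exact: emeasurable_funB.
have e0 x : (0 <= e x)%E by exact: funepos_ge0.
have fge x : (f x <= g x + e x)%E.
  rewrite /e funeposE; have := g0 x; case: (g x) => [gx| |] // _.
    by rewrite -leeBlDl// le_max lexx.
  by rewrite addye ?leey// gt_eqF// (lt_le_trans (ltNyr 0%R))// le_max lexx orbT.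
have eh x : (c^-1%:E * e x <= h x)%E.
  suff : (e x <= c%:E * h x)%E.
    move/(lee_wpmul2l (_ : 0 <= c^-1%:E)%E); rewrite lee_fin => /(_ ci0).
    by rewrite muleA -EFinM mulVf ?gt_eqF// mul1e.
  have ch0 : (0 <= c%:E * h x)%E by rewrite mule_ge0// lee_fin ltW.
  rewrite /e funeposE ge_max ch0 andbT.
  have := fgh x; have := g0 x; case: (g x) => [gx| |] // _ H.
    by rewrite leeBlDl.
  by rewrite (_ : f x - +oo = -oo)%E ?leNye//; case: (f x).
apply: (@le_trans _ _ (\int[mu]_x (g x + e x))%E).
  by apply: ge0_le_integral => //; exact: emeasurable_funD.
rewrite ge0_integralD// leeD2l//.
have -> : (\int[mu]_x e x = c%:E * \int[mu]_x (c^-1%:E * e x))%E.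
  by rewrite ge0_integralZl_EFin// muleA -EFinM mulfV ?gt_eqF// mul1e.
rewrite lee_wpmul2l ?lee_fin ?(ltW c0)//.
by apply: ge0_le_integral_nonmeasurable => // x; rewrite mule_ge0.
Qed.

Lemma conj_exp_gt0 {R : realType} (r : R) : 1 < r -> 0 < conj_exp r.
Proof.
by move=> r1; rewrite divr_gt0 ?subr_gt0// (lt_trans ltr01).
Qed.

Lemma conj_exp_inv {R : realType} (r : R) : 1 < r -> r^-1 + (conj_exp r)^-1 = 1.
Proof.
move=> r1; have r0 : 0 < r by exact: lt_trans r1.
have r10 : 0 < r - 1 by rewrite subr_gt0.
by rewrite /conj_exp; field; rewrite !gt_eqF.
Qed.

Lemma measurable_dist {d} {T : measurableType d} {R : realType}
    (D : T -> T -> R) (x : T) : (forall r, measurable (oball D x r)) ->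
  measurable_fun setT (D x).
Proof.
move=> mball; apply: (measurability _ (RGenInftyO.measurableE R)).
move=> _ [_ [r ->] <-]; rewrite setTI.
rewrite (_ : _ @^-1` _ = oball D x r); first exact: mball.
by apply/seteqP; split=> y; rewrite /oball /= in_itv.
Qed.

(** * Pointwise and Hardy estimates for [G] *)

Section weighted_space.
Context {dX : measure_display} {X : measurableType dX} {R : realType}.
Variables (mu : {measure set X -> \bar R}) (d : X -> X -> R) (a : X).
Variables (s p q : R) (v z : X -> R).
Hypotheses (metric_d : is_metric d)
  (mball : forall x r, measurable (oball d x r))
  (s0 : 0 < s) (p1 : 1 < p) (pq : p < q)
  (v0 : forall x, 0 <= v x) (mv : measurable_fun setT v)
  (z0 : forall x, 0 <= z x) (mz : measurable_fun setT z).
Local Notation p' := (conj_exp p).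
Local Notation q' := (conj_exp q).
Local Notation B := (Bx d a).
Local Notation V := (Vf mu d a v).
Local Notation W := (Wf mu d a p v z).
Local Notation A := (Af mu d a p q v z).
Local Notation G := (Gf mu d a s p q v z).
Implicit Type u : X -> R.
Local Open Scope ereal_scope.

Let p0 : (0 < p)%R. Proof. exact: lt_trans p1. Qed.
Let q0 : (0 < q)%R. Proof. exact: lt_trans pq. Qed.
Let q1 : (1 < q)%R. Proof. exact: lt_trans pq. Qed.
Let p'0 : (0 < p')%R. Proof. exact: conj_exp_gt0. Qed.
Let q'0 : (0 < q')%R. Proof. exact: conj_exp_gt0. Qed.
Let md x : measurable_fun setT (d x). Proof. exact: measurable_dist. Qed.

Let wden x := (v x `^ p)%:E * einv (z x)%:E.

Let mwden : measurable_fun setT wden.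
Proof.
apply: emeasurable_funM; first exact: measurable_powR_comp.
by apply: measurable_epow_comp; exact/measurable_EFinP.
Qed.

Let mB x : measurable (B x). Proof. exact: mball. Qed.

Lemma measurable_measure_ball : measurable_fun setT (fun x => mu (B x)).
Proof.
have -> : (fun x => mu (B x)) =
    fun x => \int[mu]_(y in [set y | (d a y < d a x)%R]) cst 1 y.
  by apply/funext => x; rewrite integral_cst ?mul1e//; exact: mball.
by apply: measurable_integral_ltset.
Qed.

Lemma measurable_Vf : measurable_fun setT V.
Proof.
by apply: measurable_integral_ltset => //; exact/measurable_EFinP.
Qed.

Lemma measurable_Wf : measurable_fun setT W.
Proof.
apply: measurable_integral_ltset => //.
  by apply: measurable_epow_comp; exact: mwden.
by move=> x; exact: epow_ge0.
Qed.

Lemma measurable_Af : measurable_fun setT A.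
Proof.
apply: emeasurable_funM; last exact/measurable_EFinP.
apply: emeasurable_funM; last exact/measurable_epow_comp/measurable_Vf.
apply: emeasurable_funM; last exact/measurable_epow_comp/measurable_Wf.
exact/measurable_epow_comp/measurable_measure_ball.
Qed.

Lemma Af_ge0 x : 0 <= A x.
Proof. by rewrite /Af !mule_ge0 ?epow_ge0 ?lee_fin. Qed.

Lemma Gf_ge0 u x : 0 <= G u x.
Proof. by rewrite /Gf !mule_ge0 ?epow_ge0 ?lee_fin. Qed.

(** This and [dual_weight] are the integrands of the two factors of [D1_at]; they become [w] and [g]
    in [hardy_ineq]. *)
Definition hardy_weight x :=
  A x * einv (epow (Defs.rad d a x)%:E (s * q) * epow (V x) q).

Definition dual_weight x :=
  epow (A x * epow (v x)%:E (- q) * einv (epow (Defs.rad d a x)%:E (s * q))) (1 - q').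

Lemma measurable_rad_epow r : measurable_fun setT (fun x => epow (Defs.rad d a x)%:E r).
Proof. by apply: measurable_epow_comp; apply/measurable_EFinP; exact: md. Qed.

Lemma measurable_hardy_weight : measurable_fun setT hardy_weight.
Proof.
apply: emeasurable_funM; first exact: measurable_Af.
apply: measurable_epow_comp; apply: emeasurable_funM.
  exact: measurable_rad_epow.
exact/measurable_epow_comp/measurable_Vf.
Qed.

Lemma measurable_dual_weight : measurable_fun setT dual_weight.
Proof.
apply: measurable_epow_comp; apply: emeasurable_funM.
  apply: emeasurable_funM; first exact: measurable_Af.
  by apply: measurable_epow_comp; exact/measurable_EFinP.
exact/measurable_epow_comp/measurable_rad_epow.
Qed.

Lemma hardy_weight_ge0 x : 0 <= hardy_weight x.
Proof. by rewrite mule_ge0 ?Af_ge0 ?einv_ge0. Qed.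

Lemma dual_weight_ge0 x : 0 <= dual_weight x.
Proof. exact: epow_ge0. Qed.

(* The junk values of [epow] at [0] and [+oo] only matter where [G] is [0] or
   [+oo]. *)
Lemma Gf_fin_pos u x : G u x != 0 -> G u x < +oo ->
  exists m om nu : R,
  [/\ (0 < m)%R, (0 < om)%R & (0 < nu)%R] /\
  [/\ (0 < v x)%R, (0 < d a x)%R & (0 < `|u x|)%R] /\
  [/\ mu (B x) = m%:E, W x = om%:E, V x = nu%:E &
      A x = (m `^ (- (q / p)) * om `^ (- (q / p')) * nu `^ q * v x)%:E].
Proof.
have pqn0 r : (0 < r)%R -> (- (q / r) != 0)%R.
  by move=> r0; rewrite oppr_eq0 gt_eqF// divr_gt0.
move=> Gn0 Glt.
have G0 : 0 < G u x by rewrite lt0e Gn0 Gf_ge0.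
have [] := @mule_fin_pos _ _ _ _ _ G0 Glt.
- by rewrite mule_ge0 ?epow_ge0 ?lee_fin.
- exact: epow_ge0.
move=> Au0 Auy r0 ry.
have [] := @mule_fin_pos _ _ _ _ _ Au0 Auy.
- exact: epow_ge0.
- by rewrite lee_fin.
rewrite lte_fin => Ae0 Aey u0 _.
have [|al al0 AE] := epow_fin_pos _ (Af_ge0 x) Ae0 Aey.
  by rewrite gt_eqF// divr_gt0.
have [||r r1 [rE]] := epow_fin_pos _ _ r0 ry.
- by rewrite oppr_eq0 gt_eqF.
- by rewrite lee_fin; apply metric_d.
have A0 : 0 < A x by rewrite AE lte_fin.
have Ay : A x < +oo by rewrite AE ltry.
have [] := @mule_fin_pos _ _ _ _ _ A0 Ay.
- by rewrite !mule_ge0 ?epow_ge0.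
- by rewrite lee_fin.
move=> MWV0 MWVy; rewrite lte_fin => vx0 _.
have [] := @mule_fin_pos _ _ _ _ _ MWV0 MWVy.
- by rewrite !mule_ge0 ?epow_ge0.
- exact: epow_ge0.
move=> MW0 MWy V0 Vy.
have [||M0 My W0 Wy] := @mule_fin_pos _ _ _ _ _ MW0 MWy.
- exact: epow_ge0.
- exact: epow_ge0.
have [||m m0 mE] := epow_fin_pos _ _ M0 My => //; first exact: pqn0.
have [||om om0 omE] := epow_fin_pos _ _ W0 Wy => //; first exact: pqn0.
- by apply: integral_ge0 => y _; exact: epow_ge0.
have [||nu nu0 nuE] := epow_fin_pos _ _ V0 Vy => //; first by rewrite gt_eqF.
- by apply: integral_ge0 => y _; rewrite lee_fin.
exists m, om, nu; split=> //; split; first by split=> //; move: r1; rewrite -rE.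
by split=> //; rewrite /Af mE omE nuE !epow_EFin.
Qed.

Lemma hardy_weightE x al nu : (0 < d a x)%R -> (0 < nu)%R -> A x = al%:E ->
  V x = nu%:E -> hardy_weight x = (al * (d a x `^ (s * q) * nu `^ q)^-1)%:E.
Proof.
move=> r0 nu0 AE VE; rewrite /hardy_weight AE VE !epow_EFin// -EFinM einv_EFin//.
by rewrite mulr_gt0 ?powR_gt0.
Qed.

(** Since [(1 - q') / q' = - 1/q], the root of the dual weight is [A^(-1/q) v |x|^s] where all
    quantities are positive and finite, and there equality holds. *)
Lemma Gf_hoelder_dual u x : G u x < +oo -> dual_weight x < +oo ->
  (`|u x| * v x)%:E <= G u x * dual_weight x `^ q'^-1.
Proof.
move=> Gy gy.
have RHS0 : 0 <= G u x * dual_weight x `^ q'^-1.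
  by rewrite mule_ge0 ?Gf_ge0 ?poweR_ge0.
have [ux|ux] := eqVneq `|u x|%R 0%R; first by rewrite ux mul0r.
have [vx|vx] := eqVneq (v x) 0%R; first by rewrite vx mulr0.
have u0 : (0 < `|u x|)%R by rewrite lt_neqAle eq_sym ux normr_ge0.
have vx0 : (0 < v x)%R by rewrite lt_neqAle eq_sym vx v0.
have e0 : (1 - q' < 0)%R.
  rewrite subr_lt0 /conj_exp ltr_pdivlMr ?subr_gt0// mul1r.
  by rewrite gtrBl.
(* If [A x = 0], the negative exponent [1 - q'] makes the dual weight infinite. *)
have An0 : A x != 0.
  apply: contraTneq gy => Ax.
  by rewrite /dual_weight Ax !mul0e epow0N ?ltxx.
have Gn0 : G u x != 0.
  rewrite /Gf !mule_eq0 !negb_or -andbA; apply/and3P; split.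
  - rewrite epow_poweR ?divr_gt0// poweR_eq0 ?Af_ge0// negb_and An0.
    by [].
  - by rewrite eqe.
  - have := @metric_d; case=> + _ => /(_ a x); rewrite le_eqVlt => /predU1P[r0|r0].
      by rewrite /Defs.rad -r0 epow0N ?oppr_lt0.
    by rewrite epow_EFin// eqe gt_eqF// powR_gt0.
have [m [om [nu [_ [[_ r0 _] [_ _ _ AE]]]]]] := Gf_fin_pos Gn0 Gy.
move: An0; rewrite /Gf /dual_weight AE; set al := (X in X%:E).
have al0' : (0 <= al)%R by rewrite -lee_fin -AE Af_ge0.
rewrite eqe => aln0; have {al0' aln0}al0 : (0 < al)%R.
  by rewrite lt_neqAle eq_sym aln0.
clearbody al.
rewrite !epow_EFin// einv_EFin ?powR_gt0// -!EFinM.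
have h0 : (0 < al * v x `^ (- q) * (d a x `^ (s * q))^-1)%R.
  by rewrite !mulr_gt0 ?invr_gt0 ?powR_gt0.
rewrite epow_EFin// poweR_EFin -EFinM lee_fin -powRrM.
have -> : ((1 - q') * q'^-1 = - q^-1)%R.
  have := conj_exp_inv q1; have q'n0 : q' != 0%R by rewrite gt_eqF.
  by rewrite mulrBl mulfV// mul1r => /eqP; rewrite addrC eq_sym -subr_eq => /eqP <-; ring.
rewrite !powRM ?mulr_ge0 ?invr_ge0 ?powR_ge0 ?(ltW al0)//.
rewrite -!powRrM -powRN -powRrM.
have -> : (- q * - q^-1 = 1)%R by rewrite mulrNN mulfV ?gt_eqF.
have -> : (- (s * q) * - q^-1 = s)%R by rewrite mulrNN -mulrA mulfV ?gt_eqF ?mulr1.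
rewrite powRr1 ?(ltW vx0)// div1r.
have -> : (al `^ q^-1 * `|u x| * d a x `^ (- s) *
    (al `^ (- q^-1) * v x * d a x `^ s) = `|u x| * v x)%R.
  have ca : (0 < al `^ q^-1)%R by rewrite powR_gt0.
  have cd : (0 < d a x `^ s)%R by rewrite powR_gt0.
  by rewrite !powRN; field; rewrite !gt_eqF.
by [].
Qed.

Definition seminorm_inner (u : X -> R) y :=
  \int[mu]_x ((`|u x - u y| `^ p * z x)%:E
    * einv ((d x y `^ (s * p))%:E * mu (oball d a (d x y / 2)))).

Lemma seminorm_inner_ge0 u y : 0 <= seminorm_inner u y.
Proof.
apply: integral_ge0 => x _; rewrite mule_ge0 ?einv_ge0// lee_fin.
by rewrite mulr_ge0 ?powR_ge0.
Qed.

Lemma measurable_osc u y r : measurable_fun setT u ->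
  measurable_fun setT (fun x => `|u x - u y| `^ r)%R.
Proof.
move=> mfu; apply: (@measurableT_comp _ _ _ _ _ _ (@powR R ^~ r)) => //.
by apply: measurableT_comp => //; apply: measurable_funB.
Qed.

(* On the ball [B y] one has [d x y < 2 d(a,y)], and the ball of radius
   [d x y / 2] around [a] is contained in [B y]. *)
Lemma integral_osc_le u y m : measurable_fun setT u -> (0 < d a y)%R ->
  (0 < m)%R -> mu (B y) = m%:E ->
  \int[mu]_(x in B y) (`|u x - u y| `^ p * z x)%:E <=
    ((2 * d a y) `^ (s * p) * m)%:E * seminorm_inner u y.
Proof.
move=> mfu r0 m0 mE.
have [d0 [deq [dC dtri]]] := metric_d.
set c := ((2 * d a y) `^ (s * p) * m)%R.
have c0 : (0 < c)%R by rewrite mulr_gt0// powR_gt0// mulr_gt0.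
have msx : measurable_fun setT (fun x => (`|u x - u y| `^ p * z x)%:E).
  by apply/measurable_EFinP/measurable_funM => //; exact: measurable_osc.
have osc0 x : 0 <= (`|u x - u y| `^ p * z x)%:E.
  by rewrite lee_fin mulr_ge0 ?powR_ge0.
have mdy : measurable_fun setT (fun x => d x y).
  by under eq_fun do rewrite dC; exact: md.
have mden : measurable_fun setT
    (fun x => (d x y `^ (s * p))%:E * mu (oball d a (d x y / 2))).
  apply: emeasurable_funM; first exact: measurable_powR_comp.
  apply: (@measurableT_comp _ _ _ _ _ _ (fun r => mu (oball d a r)) _
    (fun x => d x y / 2)%R).
    apply: nondecreasing_emeasurable => r1 r2 r12.
    apply: le_measure; rewrite ?inE; [exact: mball|exact: mball|].
    by move=> x /lt_le_trans; apply.
  exact: measurable_funM.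
have mden' := measurable_epow_comp (-1) mden.
rewrite /seminorm_inner -ge0_integralZl_EFin ?(ltW c0)//; last 2 first.
- by move=> x _; rewrite mule_ge0 ?einv_ge0.
- exact: emeasurable_funM.
rewrite [leLHS]integral_mkcond.
apply: ge0_le_integral_nonmeasurable => x.
  by apply: erestrict_ge0 => w _; exact: osc0.
rewrite patchE; case: ifPn => [xB|_]; last first.
  by rewrite mule_ge0 ?lee_fin ?(ltW c0)// mule_ge0 ?einv_ge0.
move: xB; rewrite inE /Bx /oball /= -/(Defs.rad d a y) /Defs.rad => xy.
have [dxy0|dxy0] := eqVneq (d x y) 0%R.
  have := (deq x y).1 dxy0 => ->.
  rewrite subrr normr0 powR0 ?gt_eqF// mul0r.
  by rewrite mule_ge0 ?lee_fin ?(ltW c0)// mul0e.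
have {}dxy0 : (0 < d x y)%R by rewrite lt_neqAle eq_sym dxy0 d0.
have dxy : (d x y < 2 * d a y)%R.
  apply: le_lt_trans (dtri x a y) _; rewrite (dC x a) mulr2n mulrDl mul1r.
  by rewrite ltrD2r.
have mub : mu (oball d a (d x y / 2)) <= m%:E.
  rewrite -mE; apply: le_measure; rewrite ?inE; [exact: mball|exact: mball|].
  move=> w; rewrite /oball /Bx /oball /Defs.rad /= => /lt_trans; apply.
  by rewrite ltr_pdivrMr// mulrC.
(* A null ball makes the kernel infinite, so only a vanishing oscillation needs care, and then both
   sides are 0. *)
have [mub0|mub0] := eqVneq (mu (oball d a (d x y / 2))) 0.
  rewrite mub0 mule0 einv0.
  have := osc0 x; rewrite le_eqVlt => /predU1P[<-|o0].
    by rewrite mul0e mule0.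
  by rewrite gt0_muley// gt0_muley ?lte_fin// leey.
have mubf : mu (oball d a (d x y / 2)) = (fine (mu (oball d a (d x y / 2))))%:E.
  by rewrite fineK// ge0_fin_numE// (le_lt_trans mub)// ltry.
have mubp : (0 < fine (mu (oball d a (d x y / 2))))%R.
  by rewrite -lte_fin -mubf lt0e mub0 measure_ge0.
move: mub; rewrite mubf; set b := fine _ in mubp *; rewrite lee_fin => bm.
have den0 : (0 < d x y `^ (s * p) * b)%R by rewrite mulr_gt0 ?powR_gt0.
rewrite -EFinM einv_EFin// -!EFinM lee_fin mulrCA ler_peMr//.
  by rewrite mulr_ge0 ?powR_ge0.
rewrite ler_pdivlMr// mul1r /c ler_pM ?powR_ge0 ?(ltW mubp)//.
by rewrite ge0_ler_powR ?nnegrE ?mulr_ge0 ?(ltW s0) ?(ltW p0) ?(ltW dxy) ?d0.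
Qed.

(** The factors are [|u x - u y| z^(1/p)] and [v z^(-1/p)]; the exponent in [Wf] is right because
    [1/(p-1) = p'/p]. *)
Lemma integral_osc_hoelder u y : measurable_fun setT u -> W y < +oo ->
  \int[mu]_(x in B y) (`|u x - u y| * v x)%:E <=
    (\int[mu]_(x in B y) (`|u x - u y| `^ p * z x)%:E) `^ p^-1
      * W y `^ p'^-1.
Proof.
move=> mfu Wy.
have e0 : (0 < 1 / (p - 1))%R by rewrite divr_gt0 ?subr_gt0.
have mb : measurable_fun setT (fun x => epow (wden x) (1 / (p - 1))).
  exact: measurable_epow_comp.
have b0 x : 0 <= epow (wden x) (1 / (p - 1)) by exact: epow_ge0.
have aeb := integral_lty_ae (mB y) (measurable_funS measurableT (@subsetT _ _) mb)
  (fun x _ => b0 x) Wy.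
apply: hoelder_ge0 => //.
- apply: measurable_funS measurableT _ _ => //.
  apply/measurable_EFinP/measurable_funM => //.
  by apply: measurableT_comp => //; apply: measurable_funB.
- apply: measurable_funS measurableT _ _ => //.
  by apply/measurable_EFinP/measurable_funM => //; exact: measurable_osc.
- exact: measurable_funS mb.
- by move=> x _; rewrite lee_fin mulr_ge0.
- by move=> x _; rewrite lee_fin mulr_ge0 ?powR_ge0.
- by move=> x _; exact: epow_ge0.
- exact: conj_exp_inv.
move: aeb; apply: filterS => x + xB => /(_ xB) bx.
have [vx|vx] := eqVneq (v x) 0%R.
  by rewrite vx mulr0 mule_ge0 ?poweR_ge0.
have vx0 : (0 < v x)%R by rewrite lt_neqAle eq_sym vx v0.
(* With [v x > 0] and [z x = 0] the integrand of [W y] is infinite, which finiteness of [W y]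
   excludes a.e. *)
have [zx|zx] := eqVneq (z x) 0%R.
  move: bx; rewrite /wden zx einv0 gt0_muley ?lte_fin ?powR_gt0//.
  by rewrite epow_poweR// poweRyr ?gt_eqF// ltxx.
have zx0 : (0 < z x)%R by rewrite lt_neqAle eq_sym zx z0.
have wd0 : (0 < v x `^ p * (z x)^-1)%R by rewrite mulr_gt0 ?invr_gt0 ?powR_gt0.
rewrite /wden einv_EFin// -EFinM epow_EFin// !poweR_EFin -EFinM lee_fin.
rewrite powRM ?powR_ge0// -!powRrM mulfV ?gt_eqF// powRr1//.
have -> : (1 / (p - 1) * p'^-1 = p^-1)%R.
  have p10 : (0 < p - 1)%R by rewrite subr_gt0.
  by rewrite /conj_exp; field; rewrite !gt_eqF.
rewrite powRM ?powR_ge0 ?invr_ge0 ?(ltW zx0)// -!powRrM mulfV ?gt_eqF//.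
rewrite powRr1 ?v0// -[((z x)^-1)%R]powR_inv1 ?(ltW zx0)// -powRrM mulN1r powRN.
have zp0 : (0 < z x `^ p^-1)%R by rewrite powR_gt0.
rewrite le_eqVlt; apply/orP; left; apply/eqP.
by field; rewrite gt_eqF.
Qed.

Lemma mean_osc_le u y : measurable_fun setT u ->
  `|u y|%:E * V y <= \int[mu]_(x in B y) (`|u x| * v x)%:E +
    \int[mu]_(x in B y) (`|u x - u y| * v x)%:E.
Proof.
move=> mfu.
have m1 : measurable_fun (B y) (fun x => (`|u x| * v x)%:E).
  apply: measurable_funS measurableT _ _ => //.
  by apply/measurable_EFinP/measurable_funM => //; exact: measurableT_comp.
have m2 : measurable_fun (B y) (fun x => (`|u x - u y| * v x)%:E).
  apply: measurable_funS measurableT _ _ => //.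
  apply/measurable_EFinP/measurable_funM => //.
  by apply: measurableT_comp => //; apply: measurable_funB.
rewrite -ge0_integralD//; last 2 first.
- by move=> x _; rewrite lee_fin mulr_ge0.
- by move=> x _; rewrite lee_fin mulr_ge0.
have m3 : measurable_fun (B y) (fun x => (v x)%:E).
  by apply: measurable_funS measurableT _ _ => //; exact/measurable_EFinP.
rewrite -ge0_integralZl_EFin//; last by move=> x _; rewrite lee_fin.
apply: ge0_le_integral => //.
- by move=> x _; rewrite lee_fin mulr_ge0.
- exact: measurable_funeM.
- exact: emeasurable_funD.
move=> x _; rewrite -EFinM -EFinD lee_fin -mulrDl ler_wpM2r//.
by have := ler_normB (u x) (u x - u y)%R; rewrite subKr.
Qed.

(** [G^q] equals [hardy_weight] times [(|u y| V y)^q], to which [mean_osc_le] and the convex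
    splitting apply. In the oscillation term the powers of [mu (B y)], [W], [V] and the radius
    cancel against [hardy_weight], leaving [2^(s q) v]. *)
Lemma Gf_pointwise u y t : measurable_fun setT u -> (0 < t)%R -> (t < 1)%R ->
  (fine (G u y) `^ q)%:E <=
    (t `^ (1 - q))%:E *
      (hardy_weight y * (\int[mu]_(x in B y) (`|u x| * v x)%:E) `^ q) +
    ((1 - t) `^ (1 - q) * 2 `^ (s * q))%:E *
      (epow (seminorm_inner u y) (q / p) * (v y)%:E).
Proof.
move=> mfu t0 t1.
have s1 : (0 < 1 - t)%R by rewrite subr_gt0.
set I := \int[mu]_(x in B y) (`|u x| * v x)%:E.
have I0 : 0 <= I by apply: integral_ge0 => x _; rewrite lee_fin mulr_ge0.
have qp0 : (0 < q / p)%R by rewrite divr_gt0.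
have c10 : (0 < t `^ (1 - q))%R by rewrite powR_gt0.
have c20 : (0 < (1 - t) `^ (1 - q) * 2 `^ (s * q))%R.
  by rewrite mulr_gt0 ?powR_gt0.
have RHS1 : 0 <= (t `^ (1 - q))%:E * (hardy_weight y * I `^ q).
  by rewrite mule_ge0 ?lee_fin ?powR_ge0// mule_ge0 ?hardy_weight_ge0 ?poweR_ge0.
have RHS2 : 0 <= ((1 - t) `^ (1 - q) * 2 `^ (s * q))%:E *
      (epow (seminorm_inner u y) (q / p) * (v y)%:E).
  by rewrite mule_ge0 ?lee_fin ?(ltW c20)// mule_ge0 ?epow_ge0 ?lee_fin.
(* Where [G] is 0 or [+oo] the left-hand side is 0 because of [fine]. *)
have Gcase : fine (G u y) = 0%R \/ (G u y != 0 /\ G u y < +oo).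
  have [->|Gn] := eqVneq (G u y) 0; first by left.
  have [->|Gn2] := eqVneq (G u y) +oo; first by left.
  by right; rewrite ltey.
case: Gcase => [->|[Gn0 Gy]].
  by rewrite powR0 ?gt_eqF// adde_ge0.
have [m [om [nu [[m0 om0 nu0] [[vy0 r0 uy0] [mE WE VE AE]]]]]] :=
  Gf_fin_pos Gn0 Gy.
set r := d a y in r0 *.
set al := (X in _ = X%:E) in AE.
have al0 : (0 < al)%R by rewrite !mulr_gt0 ?powR_gt0.
have GE : fine (G u y) = (al `^ (1 / q) * `|u y| * r `^ (- s))%R.
  by rewrite /Gf AE epow_EFin// /Defs.rad epow_EFin.
have wE := hardy_weightE r0 nu0 AE VE.
have w0 : (0 < al * (r `^ (s * q) * nu `^ q)^-1)%R.
  by rewrite mulr_gt0// invr_gt0 mulr_gt0 ?powR_gt0.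
have [Iy|Iy] := eqVneq I +oo.
  rewrite Iy poweRyr ?gt_eqF// wE gt0_muley ?lte_fin//.
  by rewrite gt0_muley ?lte_fin// addye ?leey// gt_eqF// (lt_le_trans (ltNyr 0%R)).
have [Ny|Ny] := eqVneq (seminorm_inner u y) +oo.
  rewrite Ny epow_poweR// poweRyr ?gt_eqF// gt0_mulye ?lte_fin//.
  by rewrite gt0_muley ?lte_fin// addey ?leey// gt_eqF// (lt_le_trans (ltNyr 0%R)).
have IE : I = (fine I)%:E by rewrite fineK// ge0_fin_numE// ltey.
have NE : seminorm_inner u y = (fine (seminorm_inner u y))%:E.
  by rewrite fineK// ge0_fin_numE ?seminorm_inner_ge0// ltey.
set i := fine I in IE; set n := fine _ in NE.
have i0 : (0 <= i)%R by exact: fine_ge0.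
have n0 : (0 <= n)%R by apply: fine_ge0; exact: seminorm_inner_ge0.
pose C := ((2 * r) `^ (s * p) * m)%R.
have C0 : (0 < C)%R by rewrite mulr_gt0// powR_gt0// mulr_gt0.
pose pi := ((C * n) `^ p^-1 * om `^ p'^-1)%R.
have pi0 : (0 <= pi)%R by rewrite mulr_ge0 ?powR_ge0.
have Hu : (`|u y| * nu <= i + pi)%R.
  rewrite -lee_fin EFinM -VE; apply: le_trans (mean_osc_le _ mfu) _.
  rewrite -/I IE EFinD leeD2l//.
  have Wy : W y < +oo by rewrite WE ltry.
  apply: le_trans (integral_osc_hoelder mfu Wy) _.
  rewrite WE /pi EFinM -2!poweR_EFin lee_wpmul2r ?poweR_ge0//.
  have O0 : 0 <= \int[mu]_(x in B y) (`|u x - u y| `^ p * z x)%:E.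
    by apply: integral_ge0 => x _; rewrite lee_fin mulr_ge0 ?powR_ge0.
  rewrite gt0_ler_poweR ?invr_ge0 ?(ltW p0)//.
  - by rewrite in_itv/= leey andbT.
  - by rewrite in_itv/= leey andbT lee_fin mulr_ge0// ltW.
  by rewrite EFinM -NE; exact: integral_osc_le.
have Gq : (fine (G u y) `^ q = al * (r `^ (s * q) * nu `^ q)^-1 * (`|u y| * nu) `^ q)%R.
  rewrite GE powRM ?mulr_ge0 ?powR_ge0// [X in (X * _ = _)%R]powRM ?powR_ge0//.
  rewrite -!powRrM mul1r mulVf ?gt_eqF// powRr1 ?(ltW al0)// mulNr powRN.
  rewrite powRM ?normr_ge0 ?(ltW nu0)//.
  have R0 : (0 < r `^ (s * q))%R by rewrite powR_gt0.
  have N0 : (0 < nu `^ q)%R by rewrite powR_gt0.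
  by field; rewrite !gt_eqF.
rewrite Gq wE IE NE epow_poweR// !poweR_EFin -!EFinM -EFinD lee_fin.
have Hq : ((`|u y| * nu) `^ q <= t `^ (1 - q) * i `^ q + (1 - t) `^ (1 - q) * pi `^ q)%R.
  apply: (@le_trans _ _ ((i + pi) `^ q)%R); last exact/powR_convex_split/ltW.
  by rewrite ge0_ler_powR ?nnegrE ?(ltW q0)// ?mulr_ge0 ?addr_ge0 ?(ltW nu0).
apply: le_trans (ler_wpM2l (ltW w0) Hq) _.
rewrite mulrDr mulrCA lerD2l mulrCA -[leRHS]mulrA ler_wpM2l ?powR_ge0//.
have piq : (pi `^ q = 2 `^ (s * q) * r `^ (s * q) * m `^ (q / p) *
    n `^ (q / p) * om `^ (q / p'))%R.
  rewrite /pi powRM ?powR_ge0// -!powRrM ![(_^-1 * q)%R]mulrC /C.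
  rewrite !powRM ?mulr_ge0 ?powR_ge0 ?(ltW r0) ?(ltW m0)//.
  by rewrite -!powRrM (_ : s * p * (q / p) = s * q)%R//; field; rewrite gt_eqF.
rewrite le_eqVlt; apply/orP; left; apply/eqP.
rewrite piq /al !powRN.
have M1 : (0 < m `^ (q / p))%R by rewrite powR_gt0.
have M2 : (0 < om `^ (q / p'))%R by rewrite powR_gt0.
have M3 : (0 < r `^ (s * q))%R by rewrite powR_gt0.
have M4 : (0 < nu `^ q)%R by rewrite powR_gt0.
by field; rewrite !gt_eqF.
Qed.

Lemma Gf_hardy u (D : R) : polar_decomposition mu d a ->
  measurable_fun setT u -> measurable_fun setT (G u) -> (0 <= D)%R ->
  (forall x, x <> a -> D1_at mu d a s p q v z x <= D%:E) ->
  \int[mu]_x G u x `^ q < +oo ->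
  \int[mu]_x (hardy_weight x * (\int[mu]_(y in B x) (`|u y| * v y)%:E) `^ q) <=
  (q' `^ (q / q') * q * D `^ q)%:E * \int[mu]_x G u x `^ q.
Proof.
move=> polar mfu mG D0 D1le GQ.
have [d0 [deq _]] := metric_d.
apply: (@hardy_ineq _ _ _ mu (d a) hardy_weight dual_weight
  (fun x => G u x `^ q) (fun x => (`|u x| * v x)%:E)) => //.
- exact: measurable_hardy_weight.
- exact: measurable_dual_weight.
- exact: measurable_poweR_comp.
- by apply/measurable_EFinP/measurable_funM => //; exact: measurableT_comp.
- exact: hardy_weight_ge0.
- exact: dual_weight_ge0.
- by move=> x; exact: poweR_ge0.
- by move=> x; rewrite lee_fin mulr_ge0.
- exact: conj_exp_inv.
- move=> r; apply: polar_sphere_null => //; first exact: measurable_dual_weight.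
  exact: dual_weight_ge0.
(* [D1] ranges over [x <> a] only; at [a] itself the open ball is empty, so [H = 0]. *)
- move=> x; have [->|xa] := pselect (x = a).
    rewrite [X in _ * X `^ _](_ : _ = 0); last first.
      rewrite (_ : [set y | _] = set0) ?integral_set0//.
      apply/seteqP; split=> // y /=; have -> : d a a = 0%R by exact/deq.
      by rewrite ltNge d0.
    by rewrite poweR0r ?gt_eqF ?invr_gt0// mule0 lee_fin.
  have := D1le x xa; rewrite /D1_at !epow_poweR ?div1r ?invr_gt0//.
- move=> x Gq gx; rewrite -poweRrM mulfV ?gt_eqF// poweRe1 ?Gf_ge0//.
  apply: Gf_hoelder_dual => //.
  by move: Gq; apply: lty_poweRy; rewrite gt_eqF.
Qed.

End weighted_space.

(** * Integration, absorption and the final constant *)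

Lemma integral_poweR_gt0 {d : measure_display} {T : measurableType d} {R : realType}
    (mu : {measure set T -> \bar R}) (g : T -> \bar R) (r : R) :
  measurable_fun setT g -> (forall x, 0 <= g x)%E -> 0 < r ->
  ~ {ae mu, forall x, g x = 0%E} -> (0 < \int[mu]_x (g x `^ r))%E.
Proof.
move=> mg g0 r0 gn0; rewrite lt0e integral_ge0 ?andbT; last first.
  by move=> x _; exact: poweR_ge0.
apply/eqP => I0; apply: gn0.
have := ae_eq0_integral0 measurableT (measurable_poweR_comp r mg)
  (fun x _ => poweR_ge0 (g x) r) I0.
by apply: filterS => x /(_ Logic.I); exact: poweR_eq0_eq0.
Qed.

Unset Implicit Arguments.

Theorem theorem2p5 (R : realType) (dX : measure_display) (X : measurableType dX)
  (mu : {measure set X -> \bar R}) (d : X -> X -> R) (a : X)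
  (s p q : R) (v z : X -> R) :
  is_metric d ->
  (forall x r, measurable (oball d a r) /\ measurable (oball d x r)) ->
  polar_decomposition mu d a ->
  0 < s -> 1 < p -> p < q ->
  (forall x, 0 <= v x) -> measurable_fun setT v ->
  (forall x, 0 <= z x) -> measurable_fun setT z ->
  (D1 mu d a s p q v z < +oo)%E ->
  (((conj_exp q) `^ (1 / conj_exp q) * q `^ (1 / q))%:E
     * D1 mu d a s p q v z < 1%:E)%E ->
  exists C : R, 0 < C /\
    forall u : X -> R, measurable_fun setT u ->
    let G := Gf mu d a s p q v z u in
    measurable_fun [set: X] (G : X -> \bar R) ->
    ('N[mu]_p%:E[G] < +oo)%E -> ('N[mu]_q%:E[G] < +oo)%E ->
    ~ {ae mu, forall x, G x = 0%E} ->
    let nGp := fine ('N[mu]_p%:E[G]) `^ p in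
    let F := fun x => fine (epow (G x) p) / nGp in
    (\int[mu]_x (F x * ln (F x))%:E
      <= (q / (q - p))%:E
         * eln (C%:E * energy mu d a s p q v z u * (nGp^-1)%:E))%E.
Proof.
move=> metric_d mballs polar s0 p1 pq v0 mv z0 mz D1fin D1K.
have mball x r : measurable (oball d x r) by exact: (mballs x r).2.
have p0 : 0 < p by exact: lt_trans p1.
have q0 : 0 < q by exact: lt_trans pq.
have q1 : 1 < q by exact: lt_trans pq.
have q'0 := conj_exp_gt0 q1.
have qp0 : 0 < q - p by rewrite subr_gt0.
(* The supremum is [-oo] when [a] is the only point, so it is cut off at 0. *)
pose M := maxe (D1 mu d a s p q v z) 0%E.
have M0 : (0 <= M)%E by rewrite le_max lexx orbT.
have Mfin : M \is a fin_num by rewrite ge0_fin_numE// gt_max D1fin ltry.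
pose D := fine M.
have ME : M = D%:E by rewrite fineK.
have D0 : 0 <= D by exact: fine_ge0.
have D1le x : x <> a -> (D1_at mu d a s p q v z x <= D%:E)%E.
  move=> xa; rewrite -ME le_max; apply/orP; left.
  by apply: ereal_sup_ubound; exists x.
pose K := conj_exp q `^ (1 / conj_exp q) * q `^ (1 / q) * D.
have K0 : 0 <= K by rewrite !mulr_ge0 ?powR_ge0.
have K1 : K < 1.
  rewrite -lte_fin /K EFinM -ME /M.
  have [Dle0|/ltW D0le] := leP (D1 mu d a s p q v z) 0%E.
    by rewrite mule0 lte_fin.
  exact: D1K.
(* [0 < t < 1] is what the convex splitting asks for, and [K <= t] yields
   [kappa <= t^(1-q) t^q = t < 1]. *)
pose t := (1 + K) / 2.
have t0 : 0 < t by rewrite /t; lra.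
have t1 : t < 1 by rewrite /t; lra.
have Kt : K <= t by rewrite /t; lra.
pose kappa := t `^ (1 - q) * K `^ q.
have kappa1 : kappa < 1.
  apply: le_lt_trans t1.
  have -> : t = t `^ (1 - q) * t `^ q.
    rewrite -powRD ?subrK ?powRr1 ?ltW//.
    by apply/implyP => _; rewrite gt_eqF.
  by rewrite ler_wpM2l ?powR_ge0// ge0_ler_powR ?nnegrE// ltW.
(* [K^q] is the constant of [hardy_ineq]. *)
have KqE : K `^ q = conj_exp q `^ (q / conj_exp q) * q * D `^ q.
  rewrite /K (powRM _ (mulr_ge0 (powR_ge0 _ _) (powR_ge0 _ _)) D0).
  rewrite (powRM _ (powR_ge0 _ _) (powR_ge0 _ _)) -!powRrM.
  by rewrite !div1r mulVf ?gt_eqF// powRr1 ?(ltW q0)// [X in _ `^ X]mulrC.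
pose c2 := (1 - t) `^ (1 - q) * 2 `^ (s * q).
have c20 : 0 < c2 by rewrite mulr_gt0 ?powR_gt0 ?subr_gt0.
(* [Q <= kappa Q + c2 e] gives [Q <= C1 e]; the power [p/q] of this is compared with the energy. *)
pose C1 := c2 / (1 - kappa).
have C10 : 0 < C1 by rewrite divr_gt0// subr_gt0.
exists (C1 `^ (p / q)); split; first exact: powR_gt0.
move=> u mfu G mG Np Nq Gn0.
pose nGp := fine 'N[mu]_p%:E[G] `^ p.
pose F x := fine (epow (G x) p) / nGp.
change (\int[mu]_x (F x * ln (F x))%:E <= (q / (q - p))%:E *
  eln ((C1 `^ (p / q))%:E * energy mu d a s p q v z u * (nGp^-1)%:E))%E.
have G0 x : (0 <= G x)%E by exact: Gf_ge0.
have IG r : r != 0 -> ('N[mu]_r%:E[G] < +oo)%E ->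
    (\int[mu]_x (G x `^ r) = (fine 'N[mu]_r%:E[G] `^ r)%:E)%E.
  move=> r0 Nr; rewrite -poweR_EFin fineK ?ge0_fin_numE ?Lnorm_ge0//.
  rewrite powR_Lnorm//; apply: eq_integral => x _; by rewrite gee0_abs.
have IP := IG p (lt0r_neq0 p0) Np; have IQ := IG q (lt0r_neq0 q0) Nq.
rewrite -/nGp in IP; set Q := _ `^ q in IQ.
have P0 : 0 < nGp by rewrite -lte_fin -IP; exact: integral_poweR_gt0.
have Q0 : 0 < Q by rewrite -lte_fin -IQ; exact: integral_poweR_gt0.
have -> : (\int[mu]_x (F x * ln (F x))%:E =
    \int[mu]_x (fine (G x `^ p) / nGp * ln (fine (G x `^ p) / nGp))%:E)%E.
  by apply: eq_integral => x _; rewrite /F epow_poweR.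
apply: le_trans (log_hoelder mG G0 p0 pq P0 Q0 IP IQ) _.
pose J y := (epow (seminorm_inner mu d a s p z u y) (q / p) * (v y)%:E)%E.
have J0 y : (0 <= J y)%E by rewrite mule_ge0 ?epow_ge0 ?lee_fin.
have QE : (Q%:E <= kappa%:E * Q%:E + c2%:E * \int[mu]_y J y)%E.
  have fGq : (\int[mu]_y (fine (G y) `^ q)%:E = Q%:E)%E.
    under eq_integral do rewrite -fine_poweR.
    rewrite ge0_integral_fine ?IQ ?ltry//.
      exact: measurable_poweR_comp.
    by move=> x; exact: poweR_ge0.
  have mI : measurable_fun setT
      (fun y => \int[mu]_(x in Bx d a y) (`|u x| * v x)%:E)%E.
    apply: measurable_integral_ltset.
    - exact: measurable_dist.
    - by apply/measurable_EFinP/measurable_funM => //; exact: measurableT_comp.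
    - by move=> x; rewrite lee_fin mulr_ge0.
  pose g y := ((t `^ (1 - q))%:E * (hardy_weight mu d a s p q v z y *
      (\int[mu]_(x in Bx d a y) (`|u x| * v x)%:E) `^ q))%E.
  have mw : measurable_fun setT (hardy_weight mu d a s p q v z).
    exact: measurable_hardy_weight.
  have mwI : measurable_fun setT (fun y => hardy_weight mu d a s p q v z y *
      (\int[mu]_(x in Bx d a y) (`|u x| * v x)%:E) `^ q)%E.
    by apply: emeasurable_funM => //; exact: measurable_poweR_comp.
  have wI0 y : (0 <= hardy_weight mu d a s p q v z y *
      (\int[mu]_(x in Bx d a y) (`|u x| * v x)%:E) `^ q)%E.
    by rewrite mule_ge0 ?poweR_ge0// hardy_weight_ge0.
  rewrite -[X in (X <= _)%E]fGq.
  apply: (@le_trans _ _ (\int[mu]_y g y + c2%:E * \int[mu]_y J y)%E).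
    (* [J] plays the role of the possibly nonmeasurable summand. *)
    apply: le_integral_add_nonmeasurable => //.
    - exact/measurable_powR_comp/measurable_fine_comp.
    - exact: measurable_funeM.
    - by move=> y; rewrite lee_fin powR_ge0.
    - by move=> y; rewrite mule_ge0 ?lee_fin ?powR_ge0.
    - by move=> y; exact: Gf_pointwise.
  rewrite leeD2r// /g ge0_integralZl_EFin ?powR_ge0//.
  rewrite /kappa EFinM -muleA lee_wpmul2l ?lee_fin ?powR_ge0//.
  rewrite KqE -IQ; apply: Gf_hardy => //.
  by rewrite IQ ltry.
have EE : energy mu d a s p q v z u = epow (\int[mu]_y J y)%E (p / q) by [].
have pq0 : 0 < p / q by rewrite divr_gt0.
have IJ0 : (0 <= \int[mu]_y J y)%E by exact: integral_ge0.
rewrite EE epow_poweR//; move: IJ0 QE.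
(* An infinite energy makes the right-hand side [+oo]. *)
case: (\int[mu]_y J y)%E => [e| |]// e0 QE; last first.
  rewrite poweRyr ?gt_eqF// gt0_muley ?lte_fin ?powR_gt0//.
  by rewrite gt0_mulye ?lte_fin ?invr_gt0// gt0_muley ?leey// lte_fin divr_gt0.
move: QE; rewrite -!EFinM -EFinD lee_fin => QE.
have QC : Q <= C1 * e.
  rewrite /C1 mulrAC ler_pdivlMr ?subr_gt0//; lra.
rewrite lee_fin in e0; clearbody C1.
have QCp : Q `^ (p / q) <= C1 `^ (p / q) * e `^ (p / q).
  rewrite -powRM// ?(ltW C10)//.
  apply: ge0_ler_powR QC; rewrite ?nnegrE; try exact: ltW.
  exact: mulr_ge0 (ltW C10) e0.
(* [Q > 0] keeps the argument of [eln] positive, so that [eln] is the real logarithm. *)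
have Qp0 : 0 < Q `^ (p / q) by rewrite powR_gt0.
have rhs0 : 0 < C1 `^ (p / q) * e `^ (p / q) / nGp.
  by rewrite divr_gt0// (lt_le_trans Qp0).
rewrite ?poweR_EFin -?EFinM /= (lt_geF rhs0) lee_fin.
rewrite ler_wpM2l ?divr_ge0 ?(ltW q0) ?(ltW qp0)//.
by rewrite ler_ln ?posrE ?(divr_gt0 Qp0 P0)// ler_wpM2r ?invr_ge0 ?(ltW P0).
Qed.
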